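(* Let $P$ be an orthogonally additive $n$-homogeneous polynomial on a Banach lattice $E$. Then $\|P\|_r=\|P\|_\infty$ if $n$ is odd, and $\|P\|_\infty\le\|P\|_r\le 2\|P\|_\infty$ if $n$ is even. These inequalities are sharp, i.e. for each even $n$ neither of the constants $1$ and $2$ in $1\cdot\|P\|_\infty\le\|P\|_r\le 2\|P\|_\infty$ can be replaced by a better constant valid for all Banach lattices $E$ and all orthogonally additive $n$-homogeneous polynomials $P$ on $E$.
   Context: All Banach lattices are real and $n$ is a positive integer. An $n$-homogeneous polynomial on $E$ is a function $P\colon E\to\mathbb{R}$ of the form $P(x)=A(x,\dots,x)$ with $A\colon E^n\to\mathbb{R}$ a bounded $n$-linear form (taken to be the unique symmetric one). $P$ is orthogonally additive if $P(x+y)=P(x)+P(y)$ whenever $x,y\in E$ are disjoint, i.e. $|x|\wedge|y|=0$. The supremum norm is $\|P\|_\infty=\sup\{|P(x)|:x\in E,\ \|x\|\le1\}$. The $n$-homogeneous polynomials are ordered by: $\widehat A\le\widehat B$ if $A(x_1,\dots,x_n)\le B(x_1,\dots,x_n)$ for all $x_1,\dots,x_n\ge 0$, where $\widehat A(x)=A(x,\dots,x)$. $P$ is regular if it is a difference of two positive $n$-homogeneous polynomials; every orthogonally additive $n$-homogeneous polynomial is regular. A regular polynomial $P=\widehat A$ has an absolute value $|P|$ in this order, which for $x\ge0$ is given by $$|P|(x)=\sup\Bigl\{\sum_{i_1,\dots,i_n}|A(u^1_{i_1},\dots,u^n_{i_n})|: u^1,\dots,u^n\in\Pi(x)\Bigr\},$$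 where $\Pi(x)$ is the set of all finite families of positive elements of $E$ whose sum is $x$. The regular norm is $\|P\|_r=\|\,|P|\,\|_\infty$. *)

(* Defs.v *)
From HB Require Import structures.
From mathcomp Require Import all_boot all_order all_algebra all_fingroup.
From mathcomp Require Import all_classical all_reals all_analysis.

Set Implicit Arguments.
Unset Strict Implicit.
Unset Printing Implicit Defensive.

Import Order.TTheory GRing.Theory Num.Theory.
Import numFieldNormedType.Exports.

Local Open Scope ring_scope.

(* A real Banach lattice: a real Banach space with a lattice order that is
   compatible with the linear structure and for which the norm is monotone in
   the modulus |x| = join x (- x).
   This is a plain record because the existing hierarchy of number structures
   does not allow a new structure joining CompleteNormedModule and POrder. The
   order is made available through the lattice instance of the carrier. *)
Record banachLatticeType (R : realType) := BanachLattice {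
  bl_space : completeNormedModType R ;
  bl_le : rel bl_space ;
  bl_meet : bl_space -> bl_space -> bl_space ;
  bl_join : bl_space -> bl_space -> bl_space ;
  bl_le_refl : reflexive bl_le ;
  bl_le_anti : antisymmetric bl_le ;
  bl_le_trans : transitive bl_le ;
  bl_meetP : forall x y z,
    bl_le x (bl_meet y z) = bl_le x y && bl_le x z ;
  bl_joinP : forall x y z,
    bl_le (bl_join x y) z = bl_le x z && bl_le y z ;
  bl_leD2r : forall x y z, bl_le x y -> bl_le (x + z) (y + z) ;
  bl_scale_ge0 : forall (a : R) x, 0 <= a -> bl_le 0 x -> bl_le 0 (a *: x) ;
  bl_le_norm : forall x y,
    bl_le (bl_join x (- x)) (bl_join y (- y)) -> `|x| <= `|y|
}.

Definition bl_carrier (R : realType) (E : banachLatticeType R) : Type :=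
  bl_space E.
Coercion bl_carrier : banachLatticeType >-> Sortclass.

HB.instance Definition _ (R : realType) (E : banachLatticeType R) :=
  CompleteNormedModule.copy (bl_carrier E) (bl_space E).
HB.instance Definition _ (R : realType) (E : banachLatticeType R) :=
  Order.Le_isPOrder.Build ring_display (bl_carrier E)
    (@bl_le_refl R E) (@bl_le_anti R E) (@bl_le_trans R E).
HB.instance Definition _ (R : realType) (E : banachLatticeType R) :=
  Order.POrder_MeetJoin_isLattice.Build ring_display (bl_carrier E)
    (@bl_meetP R E) (@bl_joinP R E).

Section HomogeneousPolynomials.
Context {R : realType} {E : banachLatticeType R}.
Implicit Types (P Q S : E -> R) (x y : E).

Definition modulus x : E := (x `|` (- x))%O.

Definition disjoint_elts x y : Prop := (modulus x `&` modulus y)%O = 0.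

Section Degree.
Variable n : nat.
Implicit Types A B : ('I_n -> E) -> R.

Definition multilinear_form A : Prop :=
  forall (x : 'I_n -> E) (i : 'I_n), scalar (fun y : E => A (dfwith x i y)).

Definition bounded_form A : Prop :=
  exists M : R, forall x : 'I_n -> E, `|A x| <= M * \prod_(i < n) `|x i|.

Definition symmetric_form A : Prop :=
  forall (s : 'S_n) (x : 'I_n -> E), A (x \o s) = A x.

Definition bounded_sym_form A : Prop :=
  [/\ multilinear_form A, bounded_form A & symmetric_form A].

Definition diag_form A : E -> R := fun x => A (fun=> x).

Definition homog_poly P : Prop :=
  exists2 A, bounded_sym_form A & P = diag_form A.

(* By polarization the symmetric forms A and B are determined by P and Q. *)
Definition poly_le P Q : Prop :=
  exists A B,
    [/\ bounded_sym_form A /\ P = diag_form A,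
        bounded_sym_form B /\ Q = diag_form B &
        forall x : 'I_n -> E, (forall i, 0 <= x i) -> A x <= B x].

(* Q is the least upper bound of P and - P among homogeneous polynomials. *)
Definition is_poly_abs P Q : Prop :=
  [/\ poly_le P Q, poly_le (\- P) Q &
      forall S, poly_le P S -> poly_le (\- P) S -> poly_le Q S].

(* The absolute value is unique if it exists; the default value 0 is used only
   if P has no absolute value, e.g. if P is not regular. *)
Definition poly_abs P : E -> R := xget (fun=> 0) (is_poly_abs P).

Definition orth_additive_poly P : Prop :=
  homog_poly P /\
  (forall x y, disjoint_elts x y -> P (x + y) = P x + P y).

End Degree.

(* For P homogeneous this is the supremum of a nonempty bounded set. *)
Definition sup_norm P : R :=
  sup [set `|P x| | x in [set x : E | `|x| <= 1]]%classic.

Definition regular_norm (n : nat) P : R := sup_norm (poly_abs n P).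

End HomogeneousPolynomials.

(* Main.v *)
Require Import Defs.
From HB Require Import structures.
From mathcomp Require Import all_boot all_order all_algebra all_fingroup.
From mathcomp Require Import all_classical all_reals all_analysis.
From mathcomp Require Import ring lra zify.

(** Let A be the symmetric form of P. Polarization turns orthogonal additivity
    of P into a statement about A: the form vanishes as soon as its arguments
    split into two nonempty groups, each member of the first being disjoint
    from each member of the second ([block_orthogonal]). On C(K) this forces
    A(f_1, ..., f_n) to be the integral of f_1 ... f_n against a signed
    measure, and the inequalities follow by taking n-th roots of functions. The
    proof below is a discrete form of that argument inside the Banach lattice,
    without a representation theorem.

    Products of elements are replaced by coefficients along a partition. If
    0 <= u <= e, then [hat_partition] writes e as a sum of elements
    p_0, ..., p_N >= 0, the hat functions of the ratio u / e on the grid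
    0, 1/N, ..., 1, with u the sum of the (a / N) p_a and with p_a, p_b disjoint
    for |a - b| >= 2. In the expansion of A along the p_a only the tuples of
    nearby indices survive, and the sum of their absolute values is bounded
    independently of N ([variation_bound]). Hence A sees only the local product
    of the coefficients of its arguments, up to an error of order 1 / N
    ([localisation]).

    The absolute value. For x_1, ..., x_n >= 0 put
      |A|(x_1, ..., x_n) = sup { A(y, x_2, ..., x_n) : |y| <= x_1 },
    a supremum of a bounded set. Additivity in x_1 is the Riesz decomposition
    property. Additivity in another variable holds because a y that is nearly
    optimal for a larger argument is nearly optimal for every smaller one
    ([transport_multiplier]). So |A| extends to a multilinear form on the whole
    space ([cone_extension]). It lies below every multilinear form that
    dominates A and - A on the positive cone; this minimality makes it symmetric
    and identifies its diagonal with |P| ([poly_absE]).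

    The norms. Consequently the regular norm of P is the supremum of
    A(y, x, ..., x) over |y| <= x with x in the unit ball. Write y as the sum of
    the zeta(a / N)^n p_a along hat functions p_a with sum x. Then
    A(y, x, ..., x) is approximately P(z), where z is the sum of the
    zeta(a / N) p_a and |z| <= x: this z plays the part of the n-th root of
    y x^(n-1) ([diagonal_approx]). If n is odd, every real number has an n-th
    root, so A(y, x, ..., x) <= ||P||. If n is even, only positive numbers do,
    and splitting y into its positive and negative parts costs a factor 2.

    Sharpness. On the plane with the maximum norm, the polynomial
    s^n - c t^n has norm 1 for n even and 0 <= c <= 1, while its regular norm
    is 1 + c. The two extreme values c = 0 and c = 1 give the two constants. *)

Set Implicit Arguments.
Unset Strict Implicit.
Unset Printing Implicit Defensive.

Import Order.TTheory GRing.Theory Num.Theory.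
Import numFieldNormedType.Exports.

Local Open Scope ring_scope.

(** * Vector lattices *)

Definition pos_part {R : realType} {E : banachLatticeType R} (x : E) : E :=
  (x `|` 0)%O.
Local Notation "x ^p" := (pos_part x) (at level 2, format "x ^p").

Section Lattice.
Context {R : realType} {E : banachLatticeType R}.
Implicit Types (x y z a b c p q : E).

Lemma bl_lerD2r z x y : (x + z <= y + z) = (x <= y).
Proof.
apply/idP/idP => [h|]; last exact: bl_leD2r.
by rewrite -(addrK z x) -(addrK z y); apply: bl_leD2r.
Qed.

Lemma bl_lerD2l z x y : (z + x <= z + y) = (x <= y).
Proof. by rewrite ![z + _]addrC bl_lerD2r. Qed.

Lemma bl_lerD x y z t : x <= y -> z <= t -> x + z <= y + t.
Proof. by move=> xy zt; apply: (@le_trans _ _ (y + z)); rewrite ?bl_lerD2r ?bl_lerD2l. Qed.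

Lemma bl_addr_ge0 x y : 0 <= x -> 0 <= y -> 0 <= x + y.
Proof. by move=> x0 y0; rewrite -[X in X <= _](addr0 0) bl_lerD. Qed.

Lemma bl_subr_ge0 x y : (0 <= y - x) = (x <= y).
Proof. by rewrite -(bl_lerD2r x 0) add0r subrK. Qed.

Lemma bl_lerBlDr x y z : (x - y <= z) = (x <= z + y).
Proof. by rewrite -(bl_lerD2r y (x - y)) subrK. Qed.

Lemma bl_lerBrDr x y z : (x <= y - z) = (x + z <= y).
Proof. by rewrite -(bl_lerD2r z x (y - z)) subrK. Qed.

Lemma bl_lerN2 x y : (- x <= - y) = (y <= x).
Proof. by rewrite -(bl_subr_ge0 (- x)) opprK addrC bl_subr_ge0. Qed.

Lemma bl_lerDl x y : (x <= x + y) = (0 <= y).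
Proof. by rewrite -[X in X <= _]addr0 bl_lerD2l. Qed.

Lemma bl_lerDr x y : (x <= y + x) = (0 <= y).
Proof. by rewrite addrC bl_lerDl. Qed.

Lemma bl_gerDl x y : (x + y <= x) = (y <= 0).
Proof. by rewrite -[X in _ <= X]addr0 bl_lerD2l. Qed.

Lemma bl_oppr_le0 x : (- x <= 0) = (0 <= x).
Proof. by rewrite -[X in _ <= X]oppr0 bl_lerN2. Qed.

Lemma bl_gerBl x y : (x - y <= x) = (0 <= y).
Proof. by rewrite bl_gerDl bl_oppr_le0. Qed.

Lemma bl_ler_wpZ (k : R) x y : 0 <= k -> x <= y -> k *: x <= k *: y.
Proof.
by move=> k0 xy; rewrite -bl_subr_ge0 -scalerBr; apply: bl_scale_ge0; rewrite ?[bl_le _ _]bl_subr_ge0.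
Qed.

Lemma bl_scaler_ge0 (k : R) x : 0 <= k -> 0 <= x -> 0 <= k *: x.
Proof. exact: bl_scale_ge0. Qed.

Lemma bl_sumr_ge0 (I : finType) (Q : pred I) (F : I -> E) :
  (forall i, Q i -> 0 <= F i) -> 0 <= \sum_(i | Q i) F i.
Proof. by move=> h; elim/big_ind : _ => //; apply: bl_addr_ge0. Qed.

Lemma bl_addrU x y z : (x `|` y)%O + z = ((x + z) `|` (y + z))%O.
Proof.
apply/le_anti/andP; split.
  by rewrite -bl_lerBrDr leUx !bl_lerBrDr leUl leUr.
by rewrite leUx !bl_lerD2r leUl leUr.
Qed.

Lemma pos_part_ge0 x : 0 <= x^p. Proof. exact: leUr. Qed.
Lemma pos_part_ge x : x <= x^p. Proof. exact: leUl. Qed.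

Lemma pos_partP x y : (x^p <= y) = (x <= y) && (0 <= y).
Proof. exact: leUx. Qed.

Lemma pos_part_id x : 0 <= x -> x^p = x.
Proof. by move=> x0; apply/join_idPl. Qed.

Lemma pos_part_le x y : x <= y -> x^p <= y^p.
Proof. by move=> xy; rewrite pos_partP pos_part_ge0 (le_trans xy) ?pos_part_ge. Qed.

Lemma pos_partB x : x^p - (- x)^p = x.
Proof.
apply/eqP; rewrite subr_eq addrC /pos_part bl_addrU addNr add0r.
by rewrite joinC.
Qed.

Lemma pos_part_disj x : (x^p `&` (- x)^p)%O = 0.
Proof.
apply/le_anti/andP; split; last by rewrite lexI !pos_part_ge0.
set m := (_ `&` _)%O.
have : x^p <= x^p - m.
  rewrite {1}/pos_part leUx bl_subr_ge0 leIl andbT.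
  rewrite bl_lerBrDr addrC -bl_lerBrDr.
  have -> : x^p - x = (- x)^p by rewrite -{2}(pos_partB x) subKr.
  exact: leIr.
by rewrite bl_lerBrDr bl_gerDl.
Qed.

Lemma pos_partD_le x y : x <= y -> - x <= y -> x^p + (- x)^p <= y.
Proof.
move=> xy nxy.
have -> : (- x)^p = x^p - x by rewrite -{3}(pos_partB x) subKr.
have h : x^p <= 2^-1 *: (y + x).
  rewrite pos_partP bl_scaler_ge0 ?andbT ?invr_ge0 //; last first.
    by rewrite -bl_lerBlDr sub0r.
  rewrite -{1}(scale1r x) -{1}(mulVf (_ : 2 != 0 :> R)) // -scalerA.
  by apply: bl_ler_wpZ; rewrite ?invr_ge0 // -[2]/(1 + 1) scalerDl !scale1r bl_lerD2r.
rewrite addrA bl_lerBlDr.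
have -> : y + x = 2^-1 *: (y + x) + 2^-1 *: (y + x).
  by rewrite -scalerDl -[LHS]scale1r; congr (_ *: _); lra.
exact: bl_lerD.
Qed.

Lemma modulusE x : modulus x = x^p + (- x)^p.
Proof.
apply/le_anti/andP; split; last by apply: pos_partD_le; rewrite ?leUl ?leUr.
rewrite leUx; apply/andP; split; apply: le_trans (pos_part_ge _) _.
  by rewrite bl_lerDl ?pos_part_ge0.
by rewrite bl_lerDr ?pos_part_ge0.
Qed.

Lemma modulus_ge0 x : 0 <= modulus x.
Proof. by rewrite modulusE bl_addr_ge0 ?pos_part_ge0. Qed.

Lemma modulus_le x y : (modulus x <= y) = (- y <= x <= y).
Proof. by rewrite leUx andbC -{1}(opprK y) bl_lerN2. Qed.

Lemma le_modulus x : - modulus x <= x <= modulus x.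
Proof. by rewrite -modulus_le. Qed.

Lemma modulus_id x : 0 <= x -> modulus x = x.
Proof.
move=> x0; apply/le_anti; rewrite leUl andbT modulus_le lexx andbT.
by apply: le_trans (_ : 0 <= _) => //; rewrite bl_oppr_le0.
Qed.

Lemma norm_le x y : - y <= x <= y -> `|x| <= `|y|.
Proof.
rewrite -modulus_le => h; apply: (@bl_le_norm R E).
by apply: (le_trans h); exact: leUl.
Qed.

Lemma norm_modulus x : `|modulus x| = `|x|.
Proof.
apply/le_anti/andP; split; last by apply: norm_le; exact: le_modulus.
apply: (@bl_le_norm R E).
by change (modulus (modulus x) <= modulus x); rewrite modulus_id ?modulus_ge0.
Qed.

(** An inequality |x| <= y between elements is used in the form
    - y <= x <= y, which behaves well under sums and scaling. *)
Lemma bnd_ge0 x y : - y <= x <= y -> 0 <= y.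
Proof. by rewrite -modulus_le; apply: le_trans; rewrite modulus_ge0. Qed.

Lemma bnd_id x : 0 <= x -> - x <= x <= x.
Proof. by move=> x0; rewrite -modulus_le modulus_id. Qed.

Lemma bndN x y : - y <= x <= y -> - y <= - x <= y.
Proof. by move=> /andP[h1 h2]; rewrite bl_lerN2 h2 -(opprK y) bl_lerN2. Qed.

Lemma bndD x y z t : - y <= x <= y -> - t <= z <= t -> - (y + t) <= x + z <= y + t.
Proof. by move=> /andP[h1 h2] /andP[h3 h4]; rewrite opprD !bl_lerD. Qed.

Lemma bnd_trans x y z : - y <= x <= y -> y <= z -> - z <= x <= z.
Proof. by rewrite -!modulus_le; apply: le_trans. Qed.

Lemma bndZ (k : R) x y : `|k| <= 1 -> - y <= x <= y -> - y <= k *: x <= y.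
Proof.
move=> k1 xy; have y0 := bnd_ge0 xy.
apply: (@bnd_trans _ (`|k| *: y)); last first.
  by rewrite -[leRHS]scale1r -bl_subr_ge0 -scalerBl bl_scaler_ge0 ?subr_ge0.
have [k0|k0] := leP 0 k.
  by rewrite ger0_norm // -scalerN; case/andP: xy => *; rewrite !bl_ler_wpZ.
rewrite ltr0_norm // -(opprK (k *: x)) -[- (k *: x)]scaleNr; apply: bndN.
by rewrite -scalerN; case/andP: xy => *; rewrite !bl_ler_wpZ // oppr_ge0 ltW.
Qed.

Lemma bndZ_ge0 (k : R) x y :
  0 <= k -> - y <= x <= y -> - (k *: y) <= k *: x <= k *: y.
Proof. by move=> k0 /andP[h1 h2]; rewrite -scalerN !bl_ler_wpZ. Qed.

Lemma bnd_sum (I : finType) (Q : pred I) (F G : I -> E) :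
  (forall i, Q i -> - G i <= F i <= G i) ->
  - (\sum_(i | Q i) G i) <= \sum_(i | Q i) F i <= \sum_(i | Q i) G i.
Proof.
move=> h; elim/big_ind2 : _ => //; first by rewrite oppr0 lexx.
by move=> *; apply: bndD.
Qed.

(** If t <= a and t <= b + c, then t - b lies below both a and c, so that
    t <= b; disjointness from a is thus stable under sums. *)
Lemma meet_addr_eq0 a b c : 0 <= a -> 0 <= b -> 0 <= c ->
  (a `&` b = 0 -> a `&` c = 0 -> a `&` (b + c) = 0)%O.
Proof.
move=> a0 b0 c0 ab ac; apply/le_anti/andP; split; last first.
  by rewrite lexI a0 bl_addr_ge0.
set t := (a `&` _)%O.
have ta : t <= a by exact: leIl.
have tbc : t <= b + c by exact: leIr.
rewrite -ab lexI ta /= -[b]add0r -bl_lerBlDr -ac lexI.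
by rewrite !bl_lerBlDr [c + b]addrC tbc andbT (le_trans ta) // -[X in X <= _]addr0 bl_lerD2l.
Qed.

Lemma disjoint_sym x y : disjoint_elts x y -> disjoint_elts y x.
Proof. by rewrite /disjoint_elts meetC. Qed.

Lemma disjoint_bnd x y p q : - p <= x <= p -> - q <= y <= q ->
  (p `&` q)%O = 0 -> disjoint_elts x y.
Proof.
rewrite -!modulus_le => xp yq pq; apply/le_anti/andP; split.
  by rewrite -pq lexI (le_trans (leIl _ _) xp) (le_trans (leIr _ _) yq).
by rewrite lexI !modulus_ge0.
Qed.

Lemma disjoint0 x : disjoint_elts x 0.
Proof.
apply/le_anti; rewrite lexI !modulus_ge0 !andbT.
by apply: (le_trans (leIr _ _)); rewrite modulus_id.
Qed.

Lemma disjointD x y z : disjoint_elts x y -> disjoint_elts x z ->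
  disjoint_elts x (y + z).
Proof.
move=> xy xz; apply: (@disjoint_bnd _ _ (modulus x) (modulus y + modulus z)).
- exact: le_modulus.
- by apply: bndD; exact: le_modulus.
- by apply: meet_addr_eq0; rewrite ?modulus_ge0.
Qed.

Lemma disjoint_sumr (I : finType) (Q : pred I) (F : I -> E) x :
  (forall i, Q i -> disjoint_elts x (F i)) ->
  disjoint_elts x (\sum_(i | Q i) F i).
Proof.
move=> h; elim/big_ind : _ => //; first exact: disjoint0.
by move=> *; apply: disjointD.
Qed.

Lemma disjoint_sum (I J : finType) (Q : pred I) (Q' : pred J) (F : I -> E) (G : J -> E) :
  (forall i j, Q i -> Q' j -> disjoint_elts (F i) (G j)) ->
  disjoint_elts (\sum_(i | Q i) F i) (\sum_(j | Q' j) G j).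
Proof.
move=> h; apply: disjoint_sumr => j Q'j; apply: disjoint_sym.
by apply: disjoint_sumr => i Qi; apply: disjoint_sym; apply: h.
Qed.

(** The first summand is y truncated to the interval between - a and a. *)
Lemma riesz_decomp2 y a b : 0 <= a -> 0 <= b -> - (a + b) <= y <= a + b ->
  exists y1 y2, [/\ y = y1 + y2, - a <= y1 <= a, - b <= y2 <= b &
    0 <= y -> 0 <= y1 /\ 0 <= y2].
Proof.
move=> a0 b0 /andP[yl yr].
have na : - a <= 0 by rewrite bl_oppr_le0.
exists ((y `&` a) `|` (- a))%O, (y - ((y `&` a) `|` (- a))%O); split.
- by rewrite addrC subrK.
- by rewrite leUr leUx leIr /= (le_trans na).
- set y1 := (_ `|` _)%O.
  have h1 : y - b <= y1.
    apply: (@le_trans _ _ (y `&` a)%O); last exact: leUl.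
    by rewrite lexI bl_gerBl b0 bl_lerBlDr.
  have h2 : y1 <= y + b.
    rewrite leUx; apply/andP; split; last by rewrite -bl_lerBlDr -opprD.
    by apply: (le_trans (leIl _ _)); rewrite bl_lerDl.
  by rewrite bl_lerBrDr addrC !bl_lerBlDr h2 addrC -bl_lerBlDr.
- move=> y0; split; first by rewrite (@le_trans _ _ (y `&` a)%O) ?leUl // lexI y0.
  by rewrite bl_subr_ge0 leUx leIl /= (le_trans na).
Qed.

Lemma riesz_decomp (m : nat) (p : 'I_m -> E) y : (forall a : 'I_m, 0 <= p a) ->
  - (\sum_a p a) <= y <= \sum_a p a ->
  exists v : 'I_m -> E, [/\ y = \sum_a v a,
    forall a : 'I_m, - p a <= v a <= p a & 0 <= y -> forall a : 'I_m, 0 <= v a].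
Proof.
elim: m p y => [|m IH] p y p0.
  rewrite !big_ord0 oppr0 => h; have -> : y = 0 by apply/le_anti; rewrite andbC.
  by exists (fun=> 0); rewrite big_ord0; split => // -[].
rewrite big_ord_recl => /riesz_decomp2[//||y1 [y2 [yE y1p y2p yge]]].
  by apply: bl_sumr_ge0.
have [//|v [vE vp vge]] := IH (fun a : 'I_m => p (lift ord0 a)) y2 _ y2p.
exists (fun a : 'I_m.+1 => oapp v y1 (unlift ord0 a)); split.
- rewrite big_ord_recl unlift_none /= yE vE; congr (_ + _).
  by apply: eq_bigr => a _; rewrite liftK.
- by move=> a; case: unliftP => [b|] -> /=.
- by move=> /yge[h1 h2] a; case: unliftP => [b|] _ /=; last by []; apply: vge.
Qed.

(** The slice of x between the levels 0 and e. *)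
Lemma pos_partB_meet x e : 0 <= e -> x^p - (x - e)^p = (x^p `&` e)%O.
Proof.
move=> e0; apply/eqP; rewrite subr_eq eq_le; apply/andP; split.
  rewrite -bl_lerBlDr lexI bl_gerBl pos_part_ge0 /= bl_lerBlDr pos_partP.
  by rewrite bl_addr_ge0 ?pos_part_ge0 // andbT addrC -bl_lerBlDr pos_part_ge.
rewrite addrC -bl_lerBrDr pos_partP bl_subr_ge0 leIl andbT.
rewrite bl_lerBrDr.
apply: (@le_trans _ _ (x - e + e)); first by rewrite bl_lerD2l leIr.
by rewrite subrK pos_part_ge.
Qed.

(** With h_k the positive part of N u - k e, the differences q_(k+1) = h_k - h_(k+1)
    decrease in k, since q_(k+1) is the slice of N u between the levels k e and
    (k + 1) e; put q_0 = e. The hat functions are p_a = q_a - q_(a+1). The two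
    sums are obtained by telescoping and by Abel summation. Since p_a lies below
    the negative part, and p_(a+2), p_(a+3), ... lie below the positive part, of
    N u - (a + 1) e, hats that are not neighbours are disjoint. The linear
    interpolation of u is exact, so that no approximation error arises here. *)
Lemma hat_partition (N : nat) (u e : E) : (0 < N)%N -> 0 <= u <= e ->
  exists p : 'I_N.+1 -> E, [/\ forall a : 'I_N.+1, 0 <= p a,
    \sum_(a < N.+1) p a = e, u = \sum_(a < N.+1) (a%:R / N%:R) *: p a &
    forall a b : 'I_N.+1, (a.+2 <= b)%N -> (p a `&` p b)%O = 0].
Proof.
move=> N0 /andP[u0 ue]; have e0 := le_trans u0 ue.
pose h (k : nat) := (u *+ N - e *+ k)^p.
have hS k : h k - h k.+1 = (h k `&` e)%O.
  by rewrite /h mulrSr opprD addrA pos_partB_meet.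
pose q (k : nat) := if k is k'.+1 then (h k' `&` e)%O else e.
have hle k : h k.+1 <= h k.
  by apply: pos_part_le; rewrite bl_lerD2l bl_lerN2 mulrSr -{1}[e *+ k]addr0 bl_lerD2l.
have qle k : q k.+1 <= q k.
  case: k => [|k] /=; first exact: leIr.
  by rewrite lexI leIr andbT (le_trans (leIl _ _)).
have hN : h N = 0.
  apply/le_anti; rewrite pos_part_ge0 andbT pos_partP lexx andbT.
  rewrite -bl_subr_ge0 sub0r opprB -mulrnBl.
  by rewrite -scaler_nat bl_scaler_ge0 ?bl_subr_ge0.
have qN : q N.+1 = 0 by rewrite /= hN; apply/meet_idPl.
have qmono i j : (i <= j)%N -> q j <= q i.
  by move=> /subnKC <-; elim: (j - i)%N => [|d IH]; rewrite ?addn0 // addnS (le_trans (qle _)).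
have qge0 k : 0 <= q k.
  by case: k => [|k] //=; rewrite lexI e0 pos_part_ge0.
exists (fun a : 'I_N.+1 => q a - q a.+1); split.
- by move=> a; rewrite bl_subr_ge0.
- rewrite -(big_mkord xpredT (fun a : nat => q a - q a.+1)).
  rewrite (@telescope_sumr_eq _ _ _ (fun k => - q k)) // => [|k _].
    by rewrite qN oppr0 sub0r opprK.
  by rewrite opprK addrC.
- have NR : N%:R != 0 :> R by rewrite pnatr_eq0 -lt0n.
  apply: (scalerI NR); rewrite scaler_sumr scaler_nat.
  have -> : u *+ N = \sum_(a < N) q a.+1.
    rewrite (eq_bigr (fun a : 'I_N => h a - h a.+1)); last by move=> a _; rewrite hS.
    rewrite -(big_mkord xpredT (fun a : nat => h a - h a.+1)).
    rewrite (@telescope_sumr_eq _ _ _ (fun k => - h k)) // => [|k _]; last by rewrite opprK addrC.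
    by rewrite hN oppr0 sub0r opprK /h mulr0n subr0 pos_part_id // -scaler_nat bl_scaler_ge0.
  transitivity (\sum_(a < N.+1) (q a - q a.+1) *+ a); last first.
    by apply: eq_bigr => a _; rewrite scalerA mulrCA mulfV // mulr1 scaler_nat.
  have aux m : \sum_(a < m.+1) (q a - q a.+1) *+ a = \sum_(a < m) q a.+1 - q m.+1 *+ m.
    elim: m => [|m IH]; first by rewrite big_ord_recl !big_ord0 mulr0n addr0 subr0.
    rewrite big_ord_recr /= IH [in RHS]big_ord_recr /= mulrnBl addrA; congr (_ - _).
    by rewrite -addrA [RHS]addrC [RHS]addrC; congr (_ + _); rewrite mulrSr addKr.
  by rewrite aux qN mul0rn subr0.
- move=> a b ab; apply/le_anti/andP; split; last first.
    by rewrite lexI !bl_subr_ge0 !qle.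
  rewrite -(pos_part_disj (u *+ N - e *+ a.+1)) lexI; apply/andP; split.
    apply: (le_trans (leIr _ _)); apply: (@le_trans _ _ (q b)).
      by rewrite bl_gerBl.
    by apply: (le_trans (qmono _ _ ab)); exact: leIl.
  apply: (le_trans (leIl _ _)); apply: (@le_trans _ _ (e - q a.+1)).
    by rewrite bl_lerD2r; apply: (qmono 0%N).
  rewrite bl_lerBlDr addrC -bl_lerBlDr lexI bl_gerBl pos_part_ge0 andbT.
  rewrite bl_lerBlDr addrC -bl_lerBlDr; apply: le_trans (pos_part_ge _).
  by rewrite opprB mulrS -addrA bl_lerD2l -opprB bl_lerN2 pos_part_ge.
Qed.

End Lattice.

(** * Expansion and polarization of multilinear forms *)

Section Dfwith.
Context {I : eqType} {T : Type}.
Implicit Types (x : I -> T) (i j : I).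

Lemma dfwith_dfwith x i y z : dfwith (dfwith x i y) i z = dfwith x i z.
Proof. by apply/funext => j; case: dfwithP => [|k ik]; rewrite ?dfwithin // !dfwithout. Qed.

Lemma dfwithC x i j y z : i != j ->
  dfwith (dfwith x i y) j z = dfwith (dfwith x j z) i y.
Proof.
move=> ij; apply/funext => k.
have [<-|ik] := eqVneq i k; first by rewrite dfwithin dfwithout 1?eq_sym // dfwithin.
rewrite [RHS]dfwithout //.
have [<-|jk] := eqVneq j k; first by rewrite !dfwithin.
by rewrite !dfwithout.
Qed.

Lemma dfwithE x i y k : dfwith x i y k = if k == i then y else x k.
Proof. by case: dfwithP => [|j ij]; rewrite ?eqxx // eq_sym (negbTE ij). Qed.
Lemma dfwith_id x i : dfwith x i (x i) = x.
Proof. by apply/funext => j; case: dfwithP. Qed.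

End Dfwith.

Lemma bounded_form_ge0 (R : realType) (E : banachLatticeType R) (n : nat)
    (A : ('I_n -> E) -> R) : bounded_form A ->
  exists2 M : R, 0 <= M & forall x : 'I_n -> E, `|A x| <= M * \prod_(i < n) `|x i|.
Proof.
move=> [M bM]; exists `|M| => // x.
by apply: (le_trans (bM x)); rewrite ler_wpM2r ?ler_norm ?prodr_ge0.
Qed.

Section Multilinear.
Context {R : realType} {E : banachLatticeType R} {n : nat}.
Variable A : ('I_n -> E) -> R.
Hypothesis mlA : multilinear_form A.
Implicit Types (x : 'I_n -> E) (y z : E).

Lemma mlD x i y z : A (dfwith x i (y + z)) = A (dfwith x i y) + A (dfwith x i z).
Proof. by have := mlA x i 1 y z; rewrite !(scale1r, mul1r). Qed.

Lemma ml0 x i : A (dfwith x i 0) = 0.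
Proof. by apply: (addrI (A (dfwith x i 0))); rewrite -mlD !addr0. Qed.

Lemma mlZ x i k y : A (dfwith x i (k *: y)) = k * A (dfwith x i y).
Proof. by have := mlA x i k y 0; rewrite !(addr0, ml0). Qed.

Lemma mlN x i y : A (dfwith x i (- y)) = - A (dfwith x i y).
Proof. by rewrite -scaleN1r mlZ mulN1r. Qed.

Lemma mlB x i y z : A (dfwith x i (y - z)) = A (dfwith x i y) - A (dfwith x i z).
Proof. by rewrite mlD mlN. Qed.

Lemma ml_sum x i (T : finType) (F : T -> E) :
  A (dfwith x i (\sum_t F t)) = \sum_t A (dfwith x i (F t)).
Proof.
by apply: (big_morph (fun y => A (dfwith x i y))) => [y z|]; rewrite ?mlD ?ml0.
Qed.

(** The coordinates are expanded one after the other. Summing over all index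
    functions J at each stage, instead of over those supported on the
    coordinates already expanded, multiplies every stage by the cardinality of
    the index type and makes the reindexing an involution. *)
Lemma ml_expand (T : finType) (v : 'I_n -> T -> E) : (0 < #|T|)%N ->
  A (fun k => \sum_t v k t) = \sum_(J : {ffun 'I_n -> T}) A (fun k => v k (J k)).
Proof.
move=> T0.
pose F m (J : {ffun 'I_n -> T}) :=
  A (fun k : 'I_n => if (k < m)%N then v k (J k) else \sum_t v k t).
pose upd (J : {ffun 'I_n -> T}) (i : 'I_n) (t : T) : {ffun 'I_n -> T} :=
  [ffun k => if k == i then t else J k].
have step m : (m < n)%N -> \sum_J F m J = #|T|%:R * \sum_J F m.+1 J.
  move=> mn; pose i := Ordinal mn.
  have FE J : F m J = \sum_t F m.+1 (upd J i t).
    have -> : F m J = A (dfwith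
        (fun k : 'I_n => if (k < m)%N then v k (J k) else \sum_t v k t) i (\sum_t v i t)).
      congr A; apply/funext => k; case: dfwithP => //=.
      by rewrite ltnn.
    rewrite ml_sum; apply: eq_bigr => t _; congr A; apply/funext => k.
    case: dfwithP => [|j ij] /=; first by rewrite ltnS leqnn ffunE eqxx.
    rewrite ffunE eq_sym (negbTE ij) ltnS (leq_eqVlt j).
    by case: eqVneq => //= jm; case/eqP: ij; apply: val_inj; rewrite /= jm.
  under eq_bigr do rewrite FE.
  rewrite pair_big /=.
  (* exchanges the value of J at i with the summation index *)
  pose h (p : {ffun 'I_n -> T} * T) := (upd p.1 i p.2, p.1 i).
  have hK : cancel h h.
    move=> [J t]; rewrite /h /= ffunE eqxx; congr pair.
    by apply/ffunP => k; rewrite !ffunE; case: eqVneq => // ->.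
  rewrite (reindex_inj (can_inj hK)) /=.
  transitivity (\sum_J \sum_(t : T) F m.+1 J).
    rewrite [RHS]pair_big /=; apply: eq_bigr => -[J t] _ /=; congr F.
    by apply/ffunP => k; rewrite !ffunE; case: eqVneq => // ->.
  rewrite mulr_sumr; apply: eq_bigr => J _.
  by rewrite sumr_const mulr_natl.
have all m : (m <= n)%N -> \sum_J F 0%N J = #|T|%:R ^+ m * \sum_J F m J.
  elim: m => [|m IH] mn; first by rewrite mul1r.
  by rewrite IH 1?ltnW // step // exprSr mulrA.
have := all n (leqnn n).
have -> : \sum_J F 0%N J = #|T|%:R ^+ n * A (fun k => \sum_t v k t).
  by rewrite /F /= sumr_const card_ffun card_ord -[LHS]mulr_natl natrX.
move=> /mulfI -> //; last by rewrite expf_neq0 // pnatr_eq0 -lt0n.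
by apply: eq_bigr => J _; congr A; apply/funext => k; rewrite ltn_ord.
Qed.

Lemma ml_scale (c : 'I_n -> R) x : A (fun k => c k *: x k) = (\prod_k c k) * A x.
Proof.
have all m : (m <= n)%N -> A (fun k : 'I_n => if (k < m)%N then c k *: x k else x k)
    = (\prod_(k < n | (k < m)%N) c k) * A x.
  elim: m => [|m IH] mn; first by rewrite big_pred0 // mul1r.
  pose i := Ordinal mn.
  rewrite (bigD1 i) //= (eq_bigl (fun k : 'I_n => (k < m)%N)); last first.
    move=> k; rewrite ltnS (leq_eqVlt k); case: eqVneq => /= [km|km].
      by rewrite (_ : k = i) ?eqxx ?ltnn //; apply: val_inj.
    by case: (k < m)%N => //=; apply/eqP => ki; rewrite ki eqxx in km.
  rewrite -mulrA -IH 1?ltnW //.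
  rewrite -[X in c i * A X](dfwith_id _ i) -mlZ; congr A; apply/funext => k.
  case: dfwithP => [|j ij] /=; first by rewrite ltnS leqnn ltnn.
  rewrite ltnS (leq_eqVlt j); case: eqVneq => //= jm.
  by case/eqP: ij; apply: val_inj; rewrite /= jm.
have -> : \prod_k c k = \prod_(k < n | (k < n)%N) c k.
  by apply: eq_bigl => k; rewrite ltn_ord.
by rewrite -all //; congr A; apply/funext => k; rewrite ltn_ord.
Qed.

Lemma ml_expandZ (T : finType) (c : 'I_n -> T -> R) (v : 'I_n -> T -> E) :
  (0 < #|T|)%N -> A (fun k => \sum_t c k t *: v k t) =
  \sum_(J : {ffun 'I_n -> T}) (\prod_k c k (J k)) * A (fun k => v k (J k)).
Proof. by move=> T0; rewrite ml_expand //; apply: eq_bigr => J _; rewrite ml_scale. Qed.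

End Multilinear.

Section Polarization.
Context {R : realType} {E : banachLatticeType R} {n : nat}.

Definition subset_sign (D : {ffun 'I_n -> bool}) : R := \prod_k (-1) ^+ D k.

(** Adding i to a subset or removing it from the subset changes the sign. *)
Lemma subset_sign_toggle (i : 'I_n) (F : {ffun 'I_n -> bool} -> R) :
  (forall D D' : {ffun 'I_n -> bool}, (forall k, k != i -> D k = D' k) -> F D = F D') ->
  \sum_D subset_sign D * F D = 0.
Proof.
move=> Fi.
pose tog (D : {ffun 'I_n -> bool}) : {ffun 'I_n -> bool} :=
  [ffun k => if k == i then ~~ D k else D k].
have togK : involutive tog.
  by move=> D; apply/ffunP => k; rewrite !ffunE; case: eqVneq; rewrite ?negbK.
suff : \sum_D subset_sign D * F D = - \sum_D subset_sign D * F D by lra.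
rewrite {1}(reindex_inj (inv_inj togK)) -sumrN; apply: eq_bigr => D _.
rewrite -mulNr (Fi (tog D) D); last by move=> k ki; rewrite ffunE (negbTE ki).
congr (_ * _); rewrite /subset_sign (bigD1 i) // [in RHS](bigD1 i) //=.
rewrite -mulNr ffunE eqxx; congr (_ * _); first by case: (D i); rewrite ?expr1 ?expr0 ?opprK.
by apply: eq_bigr => k ki; rewrite ffunE (negbTE ki).
Qed.

Variable A : ('I_n -> E) -> R.
Hypothesis mlA : multilinear_form A.
Hypothesis symA : Defs.symmetric_form A.

(** Expand the left-hand side over the maps J from the coordinates to
    themselves. If J misses a coordinate i, its coefficient does not see whether
    i belongs to D and the alternating sum vanishes; if J is a permutation, only
    the full set D contributes, and A is symmetric. *)
Lemma polarization (x : 'I_n -> E) : (0 < n)%N ->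
  \sum_D subset_sign D * diag_form A (\sum_k (D k)%:R *: x k) =
  (-1) ^+ n * (#|[pred J : {ffun 'I_n -> 'I_n} | injectiveb J]|)%:R * A x.
Proof.
move=> n0.
under eq_bigr => D _.
  rewrite /diag_form (ml_expandZ mlA (fun=> fun k => (D k)%:R) (fun=> x)) ?card_ord // mulr_sumr.
  over.
rewrite exchange_big /=.
rewrite (bigID (fun J : {ffun 'I_n -> 'I_n} => injectiveb J)) /= [X in _ + X]big1 ?addr0; last first.
  move=> J /injectiveP nJ.
  have [i iJ] : exists i, forall k, J k != i.
    apply: contra_notP nJ => nE.
    have sJ i : i \in codom J.
      by apply: contra_notT nE => niJ; exists i => k; apply: contraNneq niJ => <-; exact: codom_f.
    apply/injectiveP; apply/card_uniqP; rewrite size_map -cardE.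
    by apply: eq_card => i; rewrite !inE sJ.
  rewrite (eq_bigr (fun D => subset_sign D * ((\prod_k (D (J k))%:R) * A (fun k => x (J k))))) //.
  apply: (subset_sign_toggle (i := i)) => D D' DD'; congr (_ * _).
  by apply: eq_bigr => k _; rewrite DD'.
rewrite -mulrA [X in _ = _ * X]mulr_natl -sumr_const mulr_sumr.
apply: eq_bigr => J /injectiveP iJ.
rewrite (bigD1 [ffun=> true]) //= [X in _ + X]big1 ?addr0; last first.
  move=> D DT; have [i Di] : exists i, ~~ D i.
    apply/existsP; apply: contraR DT; rewrite negb_exists => /forallP DT.
    by apply/eqP/ffunP => i; rewrite ffunE; apply/negPn/DT.
  have /codomP[k Jk] := inj_card_onto iJ (leqnn _) i.
  by rewrite (bigD1 k) //= -Jk (negbTE Di) !mul0r mulr0.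
rewrite (eq_bigr (fun=> 1)) => [|k _]; last by rewrite ffunE.
rewrite big1_eq mul1r /subset_sign (eq_bigr (fun=> -1)) => [|k _]; last by rewrite ffunE expr1.
rewrite prodr_const card_ord; congr (_ * _).
by rewrite -[RHS](symA (perm iJ)); congr A; apply/funext => k /=; rewrite permE.
Qed.

Lemma card_inj_gt0 : (0 < #|[pred J : {ffun 'I_n -> 'I_n} | injectiveb J]|)%N.
Proof.
apply/card_gt0P; exists [ffun k => k]; rewrite inE.
by apply/injectiveP => i j; rewrite !ffunE.
Qed.

(** By additivity P(sum over D) is the sum of a term depending only on the part
    of D inside S and a term depending only on the part outside S. Each ignores
    some coordinate, so both vanish in the polarization formula. *)
Lemma block_orthogonal (x : 'I_n -> E) (S : pred 'I_n) k0 l0 :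
  (forall y z, disjoint_elts y z -> diag_form A (y + z) = diag_form A y + diag_form A z) ->
  S k0 -> ~~ S l0 ->
  (forall k l, S k -> ~~ S l -> disjoint_elts (x k) (x l)) ->
  A x = 0.
Proof.
move=> oaA Sk Sl dx.
have n0 : (0 < n)%N by apply: leq_ltn_trans (ltn_ord k0).
have := polarization x n0.
pose part (T : pred 'I_n) (D : {ffun 'I_n -> bool}) :=
  diag_form A (\sum_(k | T k) (D k)%:R *: x k).
rewrite (eq_bigr (fun D => subset_sign D * part S D + subset_sign D * part (predC S) D)); last first.
  move=> D _; rewrite -mulrDr; congr (_ * _).
  rewrite (bigID S) /= oaA //.
  apply: disjoint_sum => k l Hk Hl.
  have db (b : bool) (y : E) : - modulus y <= b%:R *: y <= modulus y.
    by apply: bndZ; [case: b; rewrite ?normr1 ?normr0 | exact: le_modulus].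
  exact: (disjoint_bnd (db _ _) (db _ _) (dx k l Hk Hl)).
rewrite big_split /= (subset_sign_toggle (i := l0)) => [|D D' DD']; last first.
  congr diag_form; apply: eq_bigr => k Hk; rewrite DD' //.
  by apply: contraNneq Sl => <-.
rewrite (subset_sign_toggle (i := k0)) => [|D D' DD']; last first.
  congr diag_form; apply: eq_bigr => k Hk; rewrite DD' //.
  by apply: contraNneq Hk => ->.
move=> /esym/eqP; rewrite addr0 !mulf_eq0 expf_eq0 oppr_eq0 oner_eq0 andbF /=.
by rewrite pnatr_eq0 gtn_eqF ?card_inj_gt0 //= => /eqP.
Qed.

End Polarization.

Lemma sym_form_unique {R : realType} {E : banachLatticeType R} {n : nat}
    (A B : ('I_n -> E) -> R) : (0 < n)%N ->
  multilinear_form A -> Defs.symmetric_form A -> multilinear_form B -> Defs.symmetric_form B ->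
  diag_form A = diag_form B -> A = B.
Proof.
move=> n0 mA sA mB sB AB; apply/funext => x.
have := polarization mB sB x n0; rewrite -AB polarization //.
apply: mulfI; rewrite mulf_neq0 ?expf_neq0 ?oppr_eq0 ?oner_eq0 //.
by rewrite pnatr_eq0 gtn_eqF ?card_inj_gt0.
Qed.

(** * Localisation of orthogonally additive forms *)

Section Localisation.
Context {R : realType} {E : banachLatticeType R} {n : nat}.
Variable A : ('I_n -> E) -> R.
Hypothesis mlA : multilinear_form A.
Hypothesis symA : Defs.symmetric_form A.
Hypothesis oaA : forall y z, disjoint_elts y z ->
  diag_form A (y + z) = diag_form A y + diag_form A z.
Variable M : R.
Hypothesis M0 : 0 <= M.
Hypothesis bdA : forall x : 'I_n -> E, `|A x| <= M * \prod_(i < n) `|x i|.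

Variables (N : nat) (p : 'I_N.+1 -> E) (v : 'I_n -> 'I_N.+1 -> E).
Hypothesis dp : forall a b : 'I_N.+1, (a.+2 <= b)%N -> (p a `&` p b)%O = 0.
Hypothesis vp : forall k (a : 'I_N.+1), - p a <= v k a <= p a.
Implicit Types J : {ffun 'I_n -> 'I_N.+1}.

(** The n indices cannot fill the n integers strictly between J k and J l
    together with J k itself, so some integer g in between is not an index. The
    arguments with index below g are disjoint from those with index above g. *)
Lemma spread_eq0 J k l : (J k + n < J l)%N -> A (fun k => v k (J k)) = 0.
Proof.
move=> kl.
have [g [kg gl gJ]] : exists g, [/\ (J k < g)%N, (g < J l)%N & forall m, J m != g :> nat].
  apply: contrapT => nE.
  have sub : {subset iota (J k) n.+1 <= [seq nat_of_ord (J m) | m <- enum 'I_n]}.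
    move=> g; rewrite mem_iota => /andP[kg gk].
    apply: contra_notT nE => gJ.
    have gJ' m : J m != g :> nat.
      by apply: contraNneq gJ => <-; apply: map_f; rewrite mem_enum.
    exists g; split => //; first by rewrite ltn_neqAle kg gJ'.
    by lia.
  have := uniq_leq_size (iota_uniq _ _) sub.
  by rewrite size_iota size_map size_enum_ord ltnn.
apply: (@block_orthogonal _ _ _ A mlA symA _ (fun m : 'I_n => (J m < g)%N) k l) => //.
  by rewrite -leqNgt ltnW.
move=> m m' mg; rewrite -leqNgt leq_eqVlt eq_sym (negbTE (gJ m')) /= => gm'.
by apply: (disjoint_bnd (vp _ _) (vp _ _)); apply: dp; lia.
Qed.

Lemma spread_le J : A (fun k => v k (J k)) != 0 -> forall k l, (J l <= J k + n)%N.
Proof. by move=> nz k l; rewrite leqNgt; apply: contra nz => /spread_eq0 ->. Qed.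

Lemma form_bound (c : 'I_n -> 'I_N.+1 -> R) :
  (forall k a, `|c k a| <= 1) ->
  `|A (fun k => \sum_a c k a *: v k a)| <= M * `|\sum_a p a| ^+ n.
Proof.
move=> c1; apply: (le_trans (bdA _)); apply: ler_wpM2l => //.
rewrite -[n in X in _ <= X]card_ord -prodr_const; apply: ler_prod => k _.
rewrite normr_ge0 /=; apply: norm_le; apply: bnd_sum => a _.
exact: bndZ.
Qed.

Definition variation_const : R := (((2 * n).+1 ^ n)%N)%:R * (M * `|\sum_a p a| ^+ n).

(** Colour the indices modulo 2 n + 1. A tuple J of spread at most n is
    determined by its value at j0 together with its colours. So, for prescribed
    colours, the signs of the A(v_J) can be absorbed in the argument number j0,
    and the sum of their absolute values is a single value of A, at arguments
    bounded by the sum of the p a. Only the number of colourings enters the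
    bound, not N. *)
Lemma variation_bound (j0 : 'I_n) :
  \sum_(J : {ffun 'I_n -> 'I_N.+1}) `|A (fun k => v k (J k))| <= variation_const.
Proof.
pose L := (2 * n)%N.
pose col (a : 'I_N.+1) : 'I_L.+1 := inord (a %% L.+1).
pose cJ J : {ffun 'I_n -> 'I_L.+1} := [ffun k => col (J k)].
rewrite (partition_big cJ xpredT) //=.
rewrite /variation_const.
have -> : (((2 * n).+1 ^ n)%N)%:R * (M * `|\sum_a p a| ^+ n) =
    \sum_(rho : {ffun 'I_n -> 'I_L.+1}) M * `|\sum_a p a| ^+ n.
  by rewrite sumr_const card_ffun !card_ord -[RHS]mulr_natl.
apply: ler_sum => rho _.
(* the sign of A on the only tuple of colours rho through a on which A is nonzero *)
pose eps (a : 'I_N.+1) := if [pick J : {ffun 'I_n -> 'I_N.+1} | [&& cJ J == rho, J j0 == a & A (fun k => v k (J k)) != 0]]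
  is Some J then Num.sg (A (fun k => v k (J k))) else 0.
pose c (k : 'I_n) (a : 'I_N.+1) := (if k == j0 then eps a else 1) * (col a == rho k)%:R.
have epsE J : cJ J == rho -> `|A (fun k => v k (J k))| = eps (J j0) * A (fun k => v k (J k)).
  move=> Jrho; have [->|nz] := eqVneq (A (fun k => v k (J k))) 0.
    by rewrite normr0 mulr0.
  rewrite /eps; case: pickP => [J' /and3P[J'rho /eqP J'0 nz']|/(_ J)]; last first.
    by rewrite Jrho eqxx nz.
  have -> : J' = J.
    apply/ffunP => k; apply: val_inj => /=.
    have := spread_le nz j0 k; have := spread_le nz k j0.
    have := spread_le nz' j0 k; have := spread_le nz' k j0.
    rewrite J'0.
    have : (J' k = J k %[mod L.+1])%N.
      move: Jrho J'rho => /eqP <- /eqP/ffunP/(_ k); rewrite !ffunE => /(congr1 val).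
      by rewrite /= !inordK ?ltn_mod.
    move: (J j0) (J k) (J' k) => [a _] [b _] [b' _] /= + h1 h2 h3 h4.
    wlog bb : b b' h1 h2 h3 h4 / (b <= b')%N.
      move=> H; have [bb|/ltnW bb] := leqP b b'; first exact: H.
      by move=> /esym h; apply: esym; apply: H.
    move=> /eqP; rewrite eqn_mod_dvd // => /dvdn_leq H.
    have [|d0] := posnP (b' - b)%N; first by lia.
    by move: (H d0); rewrite /L; lia.
  by rewrite normrEsg.
rewrite (eq_bigr _ epsE).
have -> : \sum_(J : {ffun 'I_n -> 'I_N.+1} | cJ J == rho) eps (J j0) * A (fun k => v k (J k)) =
    A (fun k => \sum_a c k a *: v k a).
  rewrite ml_expandZ ?card_ord // big_mkcond; apply: eq_bigr => J _.
  rewrite /c big_split /= -(big_mkcond (fun k => k == j0)) /= big_pred1_eq.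
  case: ifPn => [/eqP Jrho|Jrho].
    rewrite [X in _ * X * _]big1 ?mulr1 // => k _.
    by rewrite -Jrho ffunE eqxx.
  have [k kJ] : exists k, col (J k) != rho k.
    apply/existsP; apply: contraR Jrho; rewrite negb_exists => /forallP h.
    by apply/eqP/ffunP => k; rewrite ffunE; apply/eqP/negPn/h.
  by rewrite (bigD1 k) //= (negbTE kJ) mul0r mulr0 mul0r.
apply: (le_trans (ler_norm _)); apply: form_bound => k a.
rewrite /c normrM mulr_ile1 //; last by case: (_ == _); rewrite ?normr1 ?normr0.
case: (k == j0); first rewrite /eps; last by rewrite normr1.
by case: pickP => [J _|_]; rewrite ?normr0 // normr_sg; case: (_ != 0).
Qed.

(** The error is estimated only on the tuples of spread at most n; on the other
    tuples the coefficients are irrelevant because A vanishes there. *)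
Lemma localisation (al be : 'I_n -> 'I_N.+1 -> R) (d : R) : (0 < n)%N -> 0 <= d ->
  (forall J, (forall k l, (J l <= J k + n)%N) ->
     `|\prod_k al k (J k) - \prod_k be k (J k)| <= d) ->
  `|A (fun k => \sum_a al k a *: v k a) - A (fun k => \sum_a be k a *: v k a)|
    <= d * variation_const.
Proof.
move=> n0 d0 h; rewrite !ml_expandZ ?card_ord // -sumrB.
apply: (le_trans (ler_norm_sum _ _ _)).
apply: (@le_trans _ _ (\sum_(J : {ffun 'I_n -> 'I_N.+1}) d * `|A (fun k => v k (J k))|)); last first.
  by rewrite -mulr_sumr ler_wpM2l // (variation_bound (Ordinal n0)).
apply: ler_sum => J _; rewrite -mulrBl normrM.
have [->|nz] := eqVneq (A (fun k => v k (J k))) 0; first by rewrite normr0 !mulr0.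
by apply: ler_wpM2r => //; apply: h; apply: spread_le.
Qed.

End Localisation.

(** * Elementary inequalities and real roots *)

Lemma archi_div (R : realType) (c d : R) : 0 <= c -> 0 < d ->
  exists2 N : nat, (0 < N)%N & c / N%:R <= d.
Proof.
move=> c0 d0; exists (Num.bound (c / d)).+1 => //.
rewrite ler_pdivrMr ?ltr0n // mulrC -ler_pdivrMr //.
apply: ltW; apply: (lt_le_trans (archi_boundP _)); first by rewrite divr_ge0 // ltW.
by rewrite ler_nat.
Qed.

Section RealRoots.
Context {R : realType}.
Implicit Types a b s t : R.

Lemma ler_norm_prodB (m : nat) (a b : 'I_m -> R) :
  (forall k, `|a k| <= 1) -> (forall k, `|b k| <= 1) ->
  `|\prod_k a k - \prod_k b k| <= \sum_k `|a k - b k|.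
Proof.
elim: m a b => [|m IH] a b a1 b1; first by rewrite !big_ord0 subrr normr0.
rewrite !big_ord_recr /=.
set p := \prod_(_ < _) _; set q := \prod_(_ < _) _.
have -> : p * a ord_max - q * b ord_max =
  (p - q) * a ord_max + q * (a ord_max - b ord_max) by ring.
apply: (le_trans (ler_normD _ _)); rewrite !normrM; apply: lerD.
  by apply: (le_trans (ler_piMr _ (a1 _))) => //; apply: IH.
apply: ler_piMl => //; rewrite /q normr_prod; apply: prodr_ile1 => k _.
by rewrite normr_ge0 b1.
Qed.

Lemma exprB_le a b (m : nat) : (0 < m)%N -> 0 <= b -> b <= a ->
  (a - b) ^+ m <= a ^+ m - b ^+ m.
Proof.
case: m => // m _ b0 ba; have a0 := le_trans b0 ba.
have ab0 : 0 <= a - b by rewrite subr_ge0.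
elim: m => [|m IH]; first by rewrite !expr1.
rewrite !(exprS _ m.+1).
have h1 : (a - b) * (a - b) ^+ m.+1 <= (a - b) * (a ^+ m.+1 - b ^+ m.+1) by rewrite ler_wpM2l.
have h2 : b * b ^+ m.+1 <= b * a ^+ m.+1 by rewrite ler_wpM2l // lerXn2r.
have h3 : b * b ^+ m.+1 <= a * b ^+ m.+1 by rewrite ler_wpM2r // exprn_ge0.
apply: (le_trans h1); rewrite mulrBl !mulrBr; lra.
Qed.

Lemma normB_exp_le a b (m : nat) : (0 < m)%N -> 0 <= a -> 0 <= b ->
  `|a - b| ^+ m <= `|a ^+ m - b ^+ m|.
Proof.
move=> m0; wlog ba : a b / b <= a.
  by move=> H a0 b0; have [/H|/ltW/H] := leP b a; rewrite 1?[`|b - _|]distrC 1?[`|b ^+ _ - _|]distrC; apply.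
move=> a0 b0; rewrite ger0_norm ?subr_ge0 // ger0_norm ?subr_ge0 ?lerXn2r //.
exact: exprB_le.
Qed.

(** For a and b of opposite signs |a - b| <= 2 max(|a|, |b|), which accounts for
    the constant. *)
Lemma normB_exp_odd_le a b (m : nat) : odd m ->
  `|a - b| ^+ m <= 2 ^+ m * `|a ^+ m - b ^+ m|.
Proof.
move=> om; have m0 : (0 < m)%N by case: m om.
have two1 : 1 <= 2 ^+ m :> R by rewrite exprn_ege1 // ler1n.
have same (c d : R) : 0 <= c -> 0 <= d -> `|c - d| ^+ m <= 2 ^+ m * `|c ^+ m - d ^+ m|.
  move=> c0 d0; apply: (le_trans (normB_exp_le m0 c0 d0)).
  by rewrite ler_peMl.
have opp (c d : R) : 0 <= c -> 0 <= d -> `|c + d| ^+ m <= 2 ^+ m * `|c ^+ m + d ^+ m|.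
  move=> c0 d0; rewrite !ger0_norm ?addr_ge0 ?exprn_ge0 //.
  wlog dc : c d c0 d0 / d <= c.
    by move=> H; have [/H|/ltW/H] := leP d c; rewrite 1?[d + c]addrC 1?[d ^+ _ + _]addrC; apply.
  have : (c + d) ^+ m <= (2 * c) ^+ m by rewrite lerXn2r ?nnegrE ?addr_ge0 ?mulr_ge0 //; lra.
  rewrite exprMn; move=> /le_trans; apply; rewrite ler_wpM2l ?exprn_ge0 //.
  by rewrite lerDl exprn_ge0.
have expN (c : R) : (- c) ^+ m = - c ^+ m by rewrite exprNn -signr_odd om expr1 mulN1r.
have [a0|/ltW a0] := leP 0 a; have [b0|/ltW b0] := leP 0 b.
- exact: same.
- by have := opp a (- b) a0; rewrite oppr_ge0 expN; apply.
- by have := opp b (- a) b0; rewrite oppr_ge0 expN distrC [`|a ^+ m - _|]distrC; apply.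
- by have := same (- a) (- b); rewrite !oppr_ge0 !expN -!opprD !normrN; apply.
Qed.

Definition nth_root (m : nat) s : R := powR s m%:R^-1.

Lemma nth_root_ge0 m s : 0 <= nth_root m s.
Proof. exact: powR_ge0. Qed.

Lemma nth_rootK m s : (0 < m)%N -> 0 <= s -> nth_root m s ^+ m = s.
Proof.
move=> m0 s0; rewrite /nth_root -powR_mulrn ?powR_ge0 // -powRrM mulVf ?powRr1 //.
by rewrite pnatr_eq0 -lt0n.
Qed.

Lemma nth_root_le1 m s : (0 < m)%N -> 0 <= s -> s <= 1 -> nth_root m s <= 1.
Proof.
move=> m0 s0 s1; rewrite -(ler_pXn2r m0) ?nnegrE ?nth_root_ge0 //.
by rewrite nth_rootK // expr1n.
Qed.
End RealRoots.

(** * The absolute value on the positive cone *)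

Section ConeAbsoluteValue.
Context {R : realType} {E : banachLatticeType R} {n : nat}.
Variable A : ('I_n.+1 -> E) -> R.
Hypothesis mlA : multilinear_form A.
Hypothesis symA : Defs.symmetric_form A.
Hypothesis oaA : forall y z, disjoint_elts y z ->
  diag_form A (y + z) = diag_form A y + diag_form A z.
Variable M : R.
Hypothesis M0 : 0 <= M.
Hypothesis bdA : forall x : 'I_n.+1 -> E, `|A x| <= M * \prod_(i < n.+1) `|x i|.
Implicit Types x : 'I_n.+1 -> E.

(** Here y'' stands for y + (x i / e) (y' - y), a convex combination of y and y'
    at every point, and the claim is that the factor x i / e may be moved from
    one argument of A to another. The ratio is made meaningful by the hat
    functions of x i relative to e: all arguments are cut along them, and the
    piece of y' - y with index a is multiplied by a / N. *)
Lemma transport_multiplier (x : 'I_n.+1 -> E) (i : 'I_n.+1) (e y y' : E) (d : R) :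
  (forall k, 0 <= x k <= e) -> i != ord0 -> 0 < d ->
  - x ord0 <= y <= x ord0 -> - x ord0 <= y' <= x ord0 ->
  exists2 y'' : E, - x ord0 <= y'' <= x ord0 &
    A (dfwith x ord0 (y' - y)) <= A (dfwith (dfwith x i e) ord0 (y'' - y)) + d.
Proof.
move=> xe i0 d0 yx y'x.
pose K : R := (((2 * n.+1).+1 ^ n.+1)%N)%:R * (M * `|e + e| ^+ n.+1).
have K0 : 0 <= K by rewrite /K !mulr_ge0 ?exprn_ge0.
have [N N0 Nd] : exists2 N : nat, (0 < N)%N & n.+1%:R * K / N%:R <= d.
  by apply: archi_div => //; rewrite mulr_ge0.
have [p [p0 pe xip dp]] := hat_partition N0 (xe i).
have /choice[xv xvP] : forall k, exists w : 'I_N.+1 -> E,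
    [/\ x k = \sum_a w a, forall a : 'I_N.+1, - p a <= w a <= p a
       & forall a : 'I_N.+1, 0 <= w a].
  move=> k; have /andP[xk0 xke] := xe k.
  have [|w [w1 w2 w3]] := @riesz_decomp R E _ p (x k) p0.
    by rewrite pe; apply: (bnd_trans (bnd_id xk0)).
  by exists w; split => //; apply: w3.
have [x0E x0p x0ge] := xvP ord0.
rewrite x0E in yx y'x.
have [ya [yE yb _]] := riesz_decomp x0ge yx.
have [y'a [y'E y'b _]] := riesz_decomp x0ge y'x.
pose t (a : 'I_N.+1) : R := a%:R / N%:R.
have t0 a : 0 <= t a by rewrite divr_ge0.
have t1 a : t a <= 1.
  by rewrite ler_pdivrMr ?ltr0n // mul1r ler_nat -ltnS.
exists (\sum_a ((1 - t a) *: ya a + t a *: y'a a)).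
  rewrite x0E; apply: bnd_sum => a _.
  have -> : xv ord0 a = (1 - t a) *: xv ord0 a + t a *: xv ord0 a.
    by rewrite -scalerDl subrK scale1r.
  by apply: bndD; apply: bndZ_ge0; rewrite ?subr_ge0.
pose v (k : 'I_n.+1) (a : 'I_N.+1) : E :=
  if k == ord0 then y'a a - ya a else if k == i then p a else xv k a.
pose q (a : 'I_N.+1) : E := p a + p a.
pose al (k : 'I_n.+1) (a : 'I_N.+1) : R := if k == i then t a else 1.
pose be (k : 'I_n.+1) (a : 'I_N.+1) : R := if k == ord0 then t a else 1.
have pq a : p a <= q a by rewrite bl_lerDl.
have vq k (a : 'I_N.+1) : - q a <= v k a <= q a.
  rewrite /v; case: ifP => _.
    have /andP[_ xp] := x0p a.
    by apply: bndD; last apply: bndN; [apply: (bnd_trans (y'b a)) | apply: (bnd_trans (yb a))].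
  by case: ifP => _; apply: (bnd_trans _ (pq a)) => //; [exact: bnd_id | have [_ + _] := xvP k; apply].
have q0 (a : 'I_N.+1) : 0 <= q a by exact: bl_addr_ge0.
have dq (a b : 'I_N.+1) : (a.+2 <= b)%N -> (q a `&` q b)%O = 0.
  move=> ab; have h := dp a b ab.
  have h2 : (p a `&` q b)%O = 0 by exact: meet_addr_eq0.
  by rewrite meetC; apply: meet_addr_eq0 => //; rewrite meetC.
have sq : \sum_a q a = e + e by rewrite big_split /= pe.
have := @localisation R E n.+1 A mlA symA oaA M M0 bdA N q v dq vq al be
  (n.+1%:R / N%:R) (ltn0Sn n).
rewrite /variation_const sq -/K.
have -> : (fun k => \sum_a al k a *: v k a) = dfwith x ord0 (y' - y).
  apply/funext => k; rewrite dfwithE /al /v; case: (eqVneq k ord0) => [->|k0].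
        rewrite [ord0 == i]eq_sym (negbTE i0) y'E yE -sumrB.
    by apply: eq_bigr => a _; rewrite scale1r.
  case: eqVneq => [->|ki]; first by rewrite xip.
  by have [-> _ _] := xvP k; apply: eq_bigr => a _; rewrite scale1r.
have -> : (fun k => \sum_a be k a *: v k a) =
    dfwith (dfwith x i e) ord0 (\sum_a ((1 - t a) *: ya a + t a *: y'a a) - y).
  apply/funext => k; rewrite !dfwithE /be /v; case: (eqVneq k ord0) => [_|k0].
    rewrite yE -sumrB; apply: eq_bigr => a _.
    by rewrite scalerBl scale1r scalerBr addrAC addrAC addrC -!addrA addKr addrC.
  case: eqVneq => [_|ki].
    by rewrite -pe; apply: eq_bigr => a _; rewrite scale1r.
  by have [-> _ _] := xvP k; apply: eq_bigr => a _; rewrite scale1r.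
move=> H.
suff H' : `|A (dfwith x ord0 (y' - y)) -
    A (dfwith (dfwith x i e) ord0 (\sum_a ((1 - t a) *: ya a + t a *: y'a a) - y))| <= d.
  by rewrite -lerBlDl; apply: (le_trans (ler_norm _) H').
apply: (le_trans (H _ _)); [by rewrite divr_ge0 | | by rewrite mulrAC].
move=> J hJ.
have prodE (j : 'I_n.+1) : \prod_k (if k == j then t (J k) else 1) = t (J j).
  by rewrite -big_mkcond big_pred1_eq.
rewrite /al /be !prodE /t -mulrBl normrM normfV [`|N%:R|]ger0_norm //.
rewrite ler_wpM2r ?invr_ge0 // ler_norml lerNl opprB !lerBlDr -!natrD !ler_nat.
by apply/andP; split; rewrite ?[(n.+1 + _)%N]addnC hJ.
Qed.

(** The absolute value of A on the positive cone. The coordinate over which the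
    supremum is taken is an arbitrary choice; the result is symmetric. *)
Definition pos_abs x : R :=
  sup [set A (dfwith x ord0 y) | y in [set y : E | - x ord0 <= y <= x ord0]]%classic.

Lemma pos_abs_bound x (y : E) : - x ord0 <= y <= x ord0 ->
  A (dfwith x ord0 y) <= M * \prod_k `|x k|.
Proof.
move=> yx; apply: (le_trans (ler_norm _)); apply: (le_trans (bdA _)).
apply: ler_wpM2l => //; apply: ler_prod => k _; rewrite normr_ge0 /= dfwithE.
by case: eqVneq => // ->; apply: norm_le.
Qed.

Lemma pos_abs_has_sup x : 0 <= x ord0 ->
  has_sup [set A (dfwith x ord0 y) | y in [set y : E | - x ord0 <= y <= x ord0]]%classic.
Proof.
move=> x0; split; first by exists (A (dfwith x ord0 0)), 0 => //=; rewrite bl_oppr_le0 x0.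
by exists (M * \prod_k `|x k|) => _ [y yx <-]; apply: pos_abs_bound.
Qed.

Lemma pos_abs_ge x (y : E) : - x ord0 <= y <= x ord0 -> A (dfwith x ord0 y) <= pos_abs x.
Proof.
move=> yx; apply: (sup_upper_bound (pos_abs_has_sup (bnd_ge0 yx))).
by exists y.
Qed.

Lemma pos_abs_le x (c : R) : 0 <= x ord0 ->
  (forall y : E, - x ord0 <= y <= x ord0 -> A (dfwith x ord0 y) <= c) -> pos_abs x <= c.
Proof.
move=> x0 h; apply: ge_sup; first exact: (pos_abs_has_sup x0).1.
by move=> _ [y yx <-]; apply: h.
Qed.

Lemma pos_abs_ge0 x : 0 <= x ord0 -> 0 <= pos_abs x.
Proof.
move=> x0; rewrite -(ml0 mlA x ord0); apply: pos_abs_ge.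
by rewrite bl_oppr_le0 x0.
Qed.

Lemma pos_abs_adherent x (d : R) : 0 <= x ord0 -> 0 < d ->
  exists2 y : E, - x ord0 <= y <= x ord0 & pos_abs x - d < A (dfwith x ord0 y).
Proof.
move=> x0 d0; have [_ [y yx <-] h] := sup_adherent d0 (pos_abs_has_sup x0).
by exists y.
Qed.

Lemma pos_absD0 x (a b : E) : 0 <= a -> 0 <= b ->
  pos_abs (dfwith x ord0 (a + b)) = pos_abs (dfwith x ord0 a) + pos_abs (dfwith x ord0 b).
Proof.
move=> a0 b0; apply/le_anti/andP; split.
  apply: pos_abs_le; rewrite dfwithin ?bl_addr_ge0 // => y /riesz_decomp2[] // y1 [y2 [-> h1 h2 _]].
  rewrite dfwith_dfwith mlD // -[A _](congr1 A (dfwith_dfwith x ord0 a y1)).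
  rewrite -[X in _ + X](congr1 A (dfwith_dfwith x ord0 b y2)).
  by apply: lerD; apply: pos_abs_ge; rewrite dfwithin.
rewrite -lerBrDr; apply: pos_abs_le; rewrite dfwithin // => y ya; rewrite dfwith_dfwith.
rewrite lerBrDr addrC -lerBrDr; apply: pos_abs_le; rewrite dfwithin // => z zb; rewrite dfwith_dfwith.
rewrite lerBrDr -mlD // -(dfwith_dfwith x ord0 (a + b)); apply: pos_abs_ge.
by rewrite dfwithin addrC; apply: bndD.
Qed.

(** Superadditivity is the delicate half: the suprema defining the two summands
    must be reached by a common y. Choose y optimal up to d for an upper bound e
    of all the arguments. By [transport_multiplier], y is then optimal up to 2 d
    for every c between 0 and e, in particular for a and for b. *)
Lemma pos_absD_ne x i (a b : E) : (forall k, 0 <= x k) -> i != ord0 -> 0 <= a -> 0 <= b ->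
  pos_abs (dfwith x i (a + b)) = pos_abs (dfwith x i a) + pos_abs (dfwith x i b).
Proof.
move=> x0 i0 a0 b0.
have xi0 c : dfwith x i c ord0 = x ord0 by rewrite dfwithout.
apply/le_anti/andP; split.
  apply: pos_abs_le; rewrite xi0 // => y yx.
  rewrite dfwithC // mlD // -!(dfwithC _ _ _ i0).
  by apply: lerD; apply: pos_abs_ge; rewrite xi0.
apply/ler_addgt0Pr => eps eps0.
pose d := eps / 4; have d0 : 0 < d by rewrite divr_gt0.
pose e := \sum_k x k + (a + b).
have xe k : x k <= e.
  rewrite /e (bigD1 k) //= -addrA bl_lerDl bl_addr_ge0 //; first exact: bl_sumr_ge0.
  exact: bl_addr_ge0.
have ae : a <= e.
  by rewrite /e addrCA bl_lerDl bl_addr_ge0 //; apply: bl_sumr_ge0.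
have be : b <= e.
  by rewrite /e addrA bl_lerDr bl_addr_ge0 //; apply: bl_sumr_ge0.
have e0 : 0 <= e by apply: le_trans (xe ord0).
have [|y yx yopt] := @pos_abs_adherent (dfwith x i e) d _ d0; first by rewrite xi0.
rewrite xi0 in yx.
have opt c : 0 <= c -> c <= e ->
    pos_abs (dfwith x i c) <= A (dfwith (dfwith x i c) ord0 y) + (d + d).
  move=> c0 ce; apply: pos_abs_le; rewrite xi0 // => y' y'x.
  have := @transport_multiplier (dfwith x i c) i e y y' d.
  case=> //; [|by rewrite xi0..|].
    by move=> k; rewrite dfwithE; case: eqP => _; rewrite ?c0 ?x0 ?xe.
  rewrite xi0 dfwith_dfwith => y'' y''x.
  rewrite !mlB // => h.
  have : A (dfwith (dfwith x i e) ord0 y'') <= pos_abs (dfwith x i e).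
    by apply: pos_abs_ge; rewrite xi0.
  by lra.
apply: le_trans (lerD (opt a a0 ae) (opt b b0 be)) _.
have : A (dfwith (dfwith x i (a + b)) ord0 y) <= pos_abs (dfwith x i (a + b)).
  by apply: pos_abs_ge; rewrite xi0.
rewrite !(dfwithC _ _ _ i0) (mlD mlA).
have : eps = d + d + (d + d) by rewrite /d; lra.
by lra.
Qed.

Lemma pos_absD x i (a b : E) : (forall k, 0 <= x k) -> 0 <= a -> 0 <= b ->
  pos_abs (dfwith x i (a + b)) = pos_abs (dfwith x i a) + pos_abs (dfwith x i b).
Proof.
move=> x0; have [->|i0] := eqVneq i ord0; first exact: pos_absD0.
exact: pos_absD_ne.
Qed.

Lemma pos_absZ_le x i (c : R) (a : E) : (forall k, 0 <= x k) -> 0 <= c -> 0 <= a ->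
  pos_abs (dfwith x i (c *: a)) <= c * pos_abs (dfwith x i a).
Proof.
move=> x0 c0 a0; apply: pos_abs_le.
  by rewrite dfwithE; case: eqP => // _; exact: bl_scaler_ge0.
move=> y; have [->|i0] := eqVneq i ord0.
  rewrite dfwithin dfwith_dfwith => yx.
  have [cz|cn] := eqVneq c 0.
    rewrite cz mul0r (_ : y = 0) ?ml0 //; move: yx; rewrite cz scale0r oppr0.
    by move=> h; apply/le_anti; rewrite andbC.
  have cp : 0 < c by rewrite lt0r cn.
  rewrite -[y]scale1r -(mulfV cn) -scalerA mlZ // ler_wpM2l //.
  rewrite -(dfwith_dfwith x ord0 a); apply: pos_abs_ge; rewrite dfwithin.
  have := bndZ_ge0 (_ : 0 <= c^-1) yx.
  by rewrite scalerA mulVf // scale1r; apply; rewrite invr_ge0.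
rewrite dfwithout // => yx; rewrite dfwithC // mlZ // ler_wpM2l //.
by rewrite -dfwithC //; apply: pos_abs_ge; rewrite dfwithout.
Qed.

Lemma pos_absZ x i (c : R) (a : E) : (forall k, 0 <= x k) -> 0 <= c -> 0 <= a ->
  pos_abs (dfwith x i (c *: a)) = c * pos_abs (dfwith x i a).
Proof.
move=> x0 c0 a0; apply/le_anti; rewrite pos_absZ_le //=.
have [->|cn] := eqVneq c 0.
  rewrite mul0r pos_abs_ge0 // scale0r dfwithE; case: eqP => //.
have cp : 0 < c by rewrite lt0r cn.
rewrite -ler_pdivlMl //.
have := @pos_absZ_le x i c^-1 (c *: a) x0 _ _.
by rewrite scalerA mulVf // scale1r invr_ge0; apply => //; exact: bl_scaler_ge0.
Qed.
End ConeAbsoluteValue.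

(** * Multilinear extension from the positive cone *)

(** G y^p - G (- y)^p does not depend on the way in which y is written as a
    difference of positive elements. *)
Lemma cone_linear (R : realType) (E : banachLatticeType R) (G : E -> R) :
  (forall a b : E, 0 <= a -> 0 <= b -> G (a + b) = G a + G b) ->
  (forall (c : R) (a : E), 0 <= c -> 0 <= a -> G (c *: a) = c * G a) ->
  scalar (fun y : E => G y^p - G (- y)^p).
Proof.
move=> GD GZ.
have key (a b : E) : 0 <= a -> 0 <= b -> G (a - b)^p - G (- (a - b))^p = G a - G b.
  move=> a0 b0; have : G (a - b)^p + G b = G (- (a - b))^p + G a.
    rewrite -!GD ?pos_part_ge0 //; congr G.
    have -> : (a - b)^p = a - b + (- (a - b))^p by rewrite -{2}(pos_partB (a - b)) subrK.
    by rewrite addrAC subrK addrC.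
  lra.
move=> c u w /=.
have [c0|c0] := leP 0 c.
  have -> : c *: u + w = (c *: u^p + w^p) - (c *: (- u)^p + (- w)^p).
    by rewrite -{1}(pos_partB u) -{1}(pos_partB w) scalerBr opprD addrACA.
  have cu y : 0 <= c *: y^p by rewrite bl_scaler_ge0 ?pos_part_ge0.
  by rewrite key ?bl_addr_ge0 ?pos_part_ge0 // !GD ?GZ ?pos_part_ge0 //; ring.
have nc0 : 0 <= - c by rewrite oppr_ge0 ltW.
have -> : c *: u + w = (- c *: (- u)^p + w^p) - (- c *: u^p + (- w)^p).
  rewrite -{1}(pos_partB u) -{1}(pos_partB w) scalerBr opprD [RHS]addrACA; congr (_ + _).
  by rewrite !scaleNr opprK addrC.
have cu y : 0 <= - c *: y^p by rewrite bl_scaler_ge0 ?pos_part_ge0.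
by rewrite key ?bl_addr_ge0 ?pos_part_ge0 // !GD ?GZ ?pos_part_ge0 //; ring.
Qed.

Section ConeExtension.
Context {R : realType} {E : banachLatticeType R} {n : nat}.
Variable F : ('I_n -> E) -> R.
Hypothesis FD : forall (x : 'I_n -> E) i (a b : E), (forall k, 0 <= x k) ->
  0 <= a -> 0 <= b -> F (dfwith x i (a + b)) = F (dfwith x i a) + F (dfwith x i b).
Hypothesis FZ : forall (x : 'I_n -> E) i (c : R) (a : E), (forall k, 0 <= x k) ->
  0 <= c -> 0 <= a -> F (dfwith x i (c *: a)) = c * F (dfwith x i a).

Definition signed_part (b : bool) (y : E) : E := if b then (- y)^p else y^p.

Lemma signed_part_ge0 b y : 0 <= signed_part b y.
Proof. by case: b; apply: pos_part_ge0. Qed.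

(** The expansion that a multilinear extension of F must satisfy when each
    coordinate is split into its positive and negative parts. *)
Definition cone_extension (x : 'I_n -> E) : R :=
  \sum_(s : {ffun 'I_n -> bool}) subset_sign s * F (fun k => signed_part (s k) (x k)).

Lemma cone_extension_multilinear : multilinear_form cone_extension.
Proof.
move=> x i.
pose G (z : E) := \sum_(s : {ffun 'I_n -> bool} | ~~ s i)
  subset_sign s * F (dfwith (fun k => signed_part (s k) (x k)) i z).
(* the subsets containing i are matched with the others by toggling i *)
have GE y : cone_extension (dfwith x i y) = G y^p - G (- y)^p.
  pose tog (s : {ffun 'I_n -> bool}) : {ffun 'I_n -> bool} :=
    [ffun k => if k == i then ~~ s k else s k].
  have togK : involutive tog.
    by move=> D; apply/ffunP => k; rewrite !ffunE; case: eqVneq; rewrite ?negbK.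
  rewrite /cone_extension (bigID (fun s : {ffun 'I_n -> bool} => s i)) /= addrC.
  congr (_ + _).
    apply: eq_bigr => s si; congr (_ * F _); apply/funext => k.
    by rewrite !dfwithE; case: eqVneq => // ->; rewrite (negbTE si).
  rewrite (reindex_inj (inv_inj togK)) /G -sumrN; apply: eq_big => [s|s].
    by rewrite ffunE eqxx.
  rewrite ffunE eqxx => si; rewrite -mulNr; congr (_ * F _).
    rewrite /subset_sign (bigD1 i) //= [in RHS](bigD1 i) //= ffunE eqxx si (negbTE si).
    rewrite expr0 expr1 mul1r mulN1r; congr (- _).
    by apply: eq_bigr => k ki; rewrite ffunE (negbTE ki).
  apply/funext => k; rewrite !dfwithE ffunE; case: eqVneq => // ->.
  by rewrite si.
move=> c u w /=; rewrite !GE; apply: cone_linear => [a b a0 b0|k a k0 a0].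
  rewrite /G -big_split /=; apply: eq_bigr => s _.
  by rewrite -mulrDr; congr (_ * _); apply: FD => // k; apply: signed_part_ge0.
rewrite /G mulr_sumr; apply: eq_bigr => s _.
by rewrite mulrCA; congr (_ * _); apply: FZ => // j; apply: signed_part_ge0.
Qed.

Lemma cone_extensionE (x : 'I_n -> E) : (forall k, 0 <= x k) -> cone_extension x = F x.
Proof.
move=> x0; rewrite /cone_extension (bigD1 [ffun=> false]) //= big1 ?addr0.
  rewrite /subset_sign big1 => [|k _]; last by rewrite ffunE.
  by rewrite mul1r; congr F; apply/funext => k; rewrite ffunE /= pos_part_id.
move=> s s0; have [i si] : exists i, s i.
  apply/existsP; apply: contraR s0; rewrite negb_exists => /forallP h.
  by apply/eqP/ffunP => k; rewrite ffunE; apply/negbTE/h.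
have nx0 : (- x i)^p = 0.
  by apply/le_anti; rewrite pos_part_ge0 andbT pos_partP lexx andbT bl_oppr_le0.
rewrite -(dfwith_id (fun k => signed_part (s k) (x k)) i) si /= nx0 -(scale0r (0 : E)).
rewrite FZ // => [|k]; first by rewrite mul0r mulr0.
exact: signed_part_ge0.
Qed.

End ConeExtension.

(** Splitting every coordinate into its positive and negative parts writes C x
    as an alternating sum of values on the positive cone; the same sum for D
    without the signs is D at the moduli. *)
Lemma form_dominated (R : realType) (E : banachLatticeType R) (n : nat)
    (C D : ('I_n -> E) -> R) (x : 'I_n -> E) :
  multilinear_form C -> multilinear_form D ->
  (forall y : 'I_n -> E, (forall k, 0 <= y k) -> `|C y| <= D y) ->
  `|C x| <= D (fun k => modulus (x k)).
Proof.
move=> mC mD CD.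
have -> : (fun k => modulus (x k)) = (fun k => \sum_(b : bool) signed_part b (x k)).
  by apply/funext => k; rewrite big_bool /= modulusE addrC.
have {1}-> : x = (fun k => \sum_(b : bool) (-1) ^+ b *: signed_part b (x k)).
  by apply/funext => k; rewrite big_bool /= expr0 expr1 scaleN1r scale1r addrC pos_partB.
rewrite (ml_expand mD) ?card_bool // (ml_expandZ mC) ?card_bool //.
apply: (le_trans (ler_norm_sum _ _ _)); apply: ler_sum => s _.
rewrite normrM normr_prod big1 ?mul1r => [|k _]; last by rewrite normrX normrN1 expr1n.
by apply: CD => k; apply: signed_part_ge0.
Qed.

Lemma ml_eq_pos (R : realType) (E : banachLatticeType R) (n : nat)
    (C D : ('I_n -> E) -> R) : multilinear_form C -> multilinear_form D ->
  (forall y : 'I_n -> E, (forall k, 0 <= y k) -> C y = D y) -> C = D.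
Proof.
move=> mC mD CD; apply/funext => x.
have -> : x = (fun k => \sum_(b : bool) (-1) ^+ b *: signed_part b (x k)).
  by apply/funext => k; rewrite big_bool /= expr0 expr1 scaleN1r scale1r addrC pos_partB.
rewrite (ml_expandZ mC) ?card_bool // (ml_expandZ mD) ?card_bool //.
by apply: eq_bigr => s _; rewrite CD // => k; apply: signed_part_ge0.
Qed.

Lemma perm_multilinear (R : realType) (E : banachLatticeType R) (n : nat)
    (C : ('I_n -> E) -> R) (s : 'S_n) : multilinear_form C ->
  multilinear_form (fun x => C (x \o s)).
Proof.
move=> mC x i.
have h y : dfwith x i y \o s = dfwith (x \o s) ((s^-1)%g i) y.
  by apply/funext => k; rewrite /= !dfwithE (can2_eq (permK s) (permKV s)).
by move=> c u w; rewrite !h; apply: mC.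
Qed.

(** * Values on the diagonal *)

Section DiagonalBound.
Context {R : realType} {E : banachLatticeType R} {n : nat}.
Variable A : ('I_n.+1 -> E) -> R.
Hypothesis mlA : multilinear_form A.
Hypothesis symA : Defs.symmetric_form A.
Hypothesis oaA : forall y z, disjoint_elts y z ->
  diag_form A (y + z) = diag_form A y + diag_form A z.
Variable M : R.
Hypothesis M0 : 0 <= M.
Hypothesis bdA : forall x : 'I_n.+1 -> E, `|A x| <= M * \prod_(i < n.+1) `|x i|.

(** The product of the zeta(a_k / N) over a tuple of neighbouring indices a_k is
    close to zeta(a_0 / N)^n, because zeta is Hoelder continuous; this power is
    the coefficient of al u + be x. The two functions zeta used below are roots
    of s and of 2 s - 1. *)
Lemma diagonal_approx (x u : E) (zeta : R -> R) (al be C d : R) :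
  0 <= u <= x -> 0 < d -> 0 <= C ->
  (forall s, 0 <= s <= 1 -> `|zeta s| <= 1 /\ zeta s ^+ n.+1 = al * s + be) ->
  (forall s t, 0 <= s <= 1 -> 0 <= t <= 1 -> `|zeta s - zeta t| ^+ n.+1 <= C * `|s - t|) ->
  exists2 z : E, - x <= z <= x &
    `|A (dfwith (fun=> x) ord0 (al *: u + be *: x)) - diag_form A z| <= d.
Proof.
move=> ux d0 C0 zetaP zetaC.
pose K : R := (((2 * n.+1).+1 ^ n.+1)%N)%:R * (M * `|x| ^+ n.+1).
have K0 : 0 <= K by rewrite /K !mulr_ge0 ?exprn_ge0.
pose d' := d / (n.+1%:R * (K + 1)).
have nK : 0 < n.+1%:R * (K + 1) by rewrite mulr_gt0 ?ltr0n // ltr_wpDl.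
have d'0 : 0 < d' by rewrite divr_gt0.
have d'K : n.+1%:R * d' * K <= d.
  rewrite mulrAC mulrA -ler_pdivlMr ?invr_gt0 // invrK mulrC ler_wpM2l ?(ltW d0) //.
  by rewrite ler_wpM2l // lerDl.
have [N N0 Nd] : exists2 N : nat, (0 < N)%N & C * n.+1%:R / N%:R <= d' ^+ n.+1.
  by apply: archi_div => //; rewrite ?mulr_ge0 // exprn_gt0.
have [p [p0 px uE dp]] := hat_partition N0 ux.
pose t (a : 'I_N.+1) : R := a%:R / N%:R.
have t01 a : 0 <= t a <= 1.
  by rewrite divr_ge0 //= ler_pdivrMr ?ltr0n // mul1r ler_nat -ltnS.
have [z1 zE] : (forall a, `|zeta (t a)| <= 1) /\
    forall a, zeta (t a) ^+ n.+1 = al * t a + be.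
  by split=> a; have [] := zetaP _ (t01 a).
exists (\sum_a zeta (t a) *: p a).
  by rewrite -px; apply: bnd_sum => a _; apply: bndZ => //; apply: bnd_id.
pose al' (k : 'I_n.+1) (a : 'I_N.+1) : R := if k == ord0 then zeta (t a) ^+ n.+1 else 1.
pose be' (k : 'I_n.+1) (a : 'I_N.+1) : R := zeta (t a).
have vp (k : 'I_n.+1) (a : 'I_N.+1) : - p a <= p a <= p a by exact: bnd_id.
have := @localisation R E n.+1 A mlA symA oaA M M0 bdA N p (fun=> p) dp vp al' be'
  (n.+1%:R * d') (ltn0Sn n).
rewrite /variation_const px -/K.
have -> : (fun k => \sum_a al' k a *: p a) = dfwith (fun=> x) ord0 (al *: u + be *: x).
  apply/funext => k; rewrite dfwithE /al'; case: ifP => _.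
    rewrite uE -[in RHS]px !scaler_sumr -big_split; apply: eq_bigr => a _ /=.
    by rewrite zE scalerDl scalerA.
  by rewrite -px; apply: eq_bigr => a _; rewrite scale1r.
have -> : A (fun k => \sum_a be' k a *: p a) = diag_form A (\sum_a zeta (t a) *: p a) by [].
move=> H; apply: (le_trans (H _ _)) => //; first by rewrite mulr_ge0 // ltW.
move=> J hJ.
have -> : \prod_k al' k (J k) = \prod_(k < n.+1) zeta (t (J ord0)).
  by rewrite /al' -big_mkcond big_pred1_eq prodr_const card_ord.
apply: (le_trans (ler_norm_prodB (fun=> z1 _) (fun k => z1 (J k)))).
have -> : n.+1%:R * d' = \sum_(k < n.+1) d' by rewrite sumr_const card_ord mulr_natl.
apply: ler_sum => k _.
rewrite -(ler_pXn2r (ltn0Sn n)) ?nnegrE ?normr_ge0 ?(ltW d'0) //.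
apply: (le_trans (zetaC _ _ (t01 _) (t01 _))).
apply: (le_trans _ Nd); rewrite -mulrA ler_wpM2l // /t -mulrBl normrM normfV [`|N%:R|]ger0_norm //.
rewrite ler_wpM2r ?invr_ge0 // ler_norml lerNl opprB !lerBlDr -!natrD !ler_nat.
by apply/andP; split; rewrite ?[(n.+1 + _)%N]addnC hJ.
Qed.

Variable B : R.
Hypothesis diagB : forall x : E, `|x| <= 1 -> `|diag_form A x| <= B.

Lemma diagonal_bound_pos (x u : E) : `|x| <= 1 -> 0 <= u <= x ->
  `|A (dfwith (fun=> x) ord0 u)| <= B.
Proof.
move=> x1 ux; apply/ler_addgt0Pr => d d0.
have [s||z zx] := @diagonal_approx x u (nth_root n.+1) 1 0 1 d ux d0 ler01.
- move=> /andP[s0 s1]; rewrite ger0_norm ?nth_root_ge0 // nth_root_le1 // nth_rootK //.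
  by rewrite mul1r addr0.
- move=> s t /andP[s0 s1] /andP[t0 t1].
  by have := normB_exp_le (ltn0Sn n) (nth_root_ge0 n.+1 s) (nth_root_ge0 n.+1 t); rewrite !nth_rootK // mul1r.
rewrite scale1r scale0r addr0 => h.
have zB : `|diag_form A z| <= B.
  by apply: diagB; apply: le_trans (norm_le zx) x1.
set a := A _ in h *; set b := diag_form A z in h zB *.
have : `|a| <= `|a - b| + `|b| by rewrite -{1}(subrK b a) ler_normD.
lra.
Qed.

(** For arbitrary degree only positive elements are accessible to n-th roots, so
    that y^p and (- y)^p are estimated separately. *)
Lemma diagonal_bound (x y : E) : `|x| <= 1 -> - x <= y <= x ->
  A (dfwith (fun=> x) ord0 y) <= 2 * B.
Proof.
move=> x1 yx; have x0 := bnd_ge0 yx.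
have /andP[yl yr] := yx.
have h1 : `|A (dfwith (fun=> x) ord0 y^p)| <= B.
  by apply: diagonal_bound_pos; rewrite // pos_part_ge0 pos_partP yr.
have h2 : `|A (dfwith (fun=> x) ord0 (- y)^p)| <= B.
  apply: diagonal_bound_pos; rewrite // pos_part_ge0 pos_partP x0 andbT /=.
  by rewrite -(opprK x) bl_lerN2.
rewrite -(pos_partB y) mlB //.
move: h1 h2; rewrite !ler_norml => /andP[_ h1] /andP[h2 _]; lra.
Qed.

(** Here y = 2 u - x for some u with 0 <= u <= x, and for odd n the numbers
    2 s - 1 in the interval from -1 to 1 all have real n-th roots. *)
Lemma diagonal_bound_odd (x y : E) : odd n.+1 -> `|x| <= 1 -> - x <= y <= x ->
  A (dfwith (fun=> x) ord0 y) <= B.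
Proof.
move=> on x1 yx; have x0 := bnd_ge0 yx; apply/ler_addgt0Pr => d d0.
have /andP[yl yr] := yx.
pose zeta (s : R) := if 0 <= 2 * s - 1 then nth_root n.+1 (2 * s - 1)
  else - nth_root n.+1 (1 - 2 * s).
have zE s : zeta s ^+ n.+1 = 2 * s - 1.
  rewrite /zeta; case: (leP 0 (2 * s - 1)) => s0; first by rewrite nth_rootK.
  by rewrite exprNn -signr_odd on expr1 mulN1r nth_rootK //; lra.
pose u : E := 2^-1 *: (y + x).
have yE : y = 2 *: u + (-1) *: x.
  by rewrite /u scalerA mulfV // scale1r scaleN1r addrK.
have ux : 0 <= u <= x.
  rewrite /u bl_scaler_ge0 ?invr_ge0 //=; last by rewrite -bl_lerBlDr sub0r.
  have {2}-> : x = 2^-1 *: (x + x).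
    by rewrite -mulr2n -[x *+ 2]scaler_nat scalerA mulVf // scale1r.
  by apply: bl_ler_wpZ; rewrite ?invr_ge0 // bl_lerD2r.
have C0 : 0 <= 2 ^+ n.+1 * 2 :> R by rewrite mulr_ge0 // exprn_ge0.
have [s||z zx] := @diagonal_approx x u zeta 2 (-1) (2 ^+ n.+1 * 2) d ux d0 C0.
- move=> /andP[s0 s1]; split; last exact: zE.
  by rewrite /zeta; case: (leP 0 (2 * s - 1)) => h; rewrite ?normrN ger0_norm ?nth_root_ge0 // nth_root_le1 //; lra.
- move=> s t _ _; apply: (le_trans (normB_exp_odd_le _ _ on)).
  rewrite !zE -mulrA ler_wpM2l ?exprn_ge0 //.
  have -> : 2 * s - 1 - (2 * t - 1) = 2 * (s - t) by ring.
  by rewrite normrM ger0_norm.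
rewrite -yE => h.
have zB : `|diag_form A z| <= B.
  by apply: diagB; apply: le_trans (norm_le zx) x1.
move: h zB; rewrite !ler_norml => /andP[_ h] /andP[_ zB]; lra.
Qed.

End DiagonalBound.

(** * The absolute value of a polynomial and its norm *)

Section SymmetricForms.
Context {R : realType} {E : banachLatticeType R} {n : nat}.

Lemma form_unique (C D : ('I_n.+1 -> E) -> R) :
  bounded_sym_form C -> bounded_sym_form D -> diag_form C = diag_form D -> C = D.
Proof. by move=> [? _ ?] [? _ ?]; apply: sym_form_unique. Qed.

Lemma oppr_bounded_sym (C : ('I_n.+1 -> E) -> R) :
  bounded_sym_form C -> bounded_sym_form (\- C).
Proof.
move=> [mC [K bC] sC]; split; [|exists K => x; by rewrite normrN|by move=> s x /=; rewrite sC].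
move=> x i c u w /=; have /= := mC x i c u w => ->.
by rewrite opprD mulrN.
Qed.

Lemma poly_le_anti (P Q : E -> R) : poly_le n.+1 P Q -> poly_le n.+1 Q P -> P = Q.
Proof.
move=> [C [D [[bC PC] [bD QD] CD]]] [D' [C' [[bD' QD'] [bC' PC'] DC]]].
have CC : C' = C by apply: form_unique => //; rewrite -PC -PC'.
have DD : D' = D by apply: form_unique => //; rewrite -QD -QD'.
subst C' D'; rewrite PC QD; congr diag_form; apply: ml_eq_pos.
- by case: bC.
- by case: bD.
- by move=> y y0; apply/le_anti; rewrite CD // DC.
Qed.

End SymmetricForms.

Lemma sup_norm_le (R : realType) (E : banachLatticeType R) (P : E -> R) (c : R) :
  (forall x : E, `|x| <= 1 -> `|P x| <= c) -> sup_norm P <= c.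
Proof.
move=> h; apply: ge_sup; last by move=> _ [x x1 <-]; exact: h.
by exists `|P 0|, 0 => //=; rewrite normr0.
Qed.

Section AbsoluteValue.
Context {R : realType} {E : banachLatticeType R} {n : nat}.
Variable A : ('I_n.+1 -> E) -> R.
Hypothesis mlA : multilinear_form A.
Hypothesis symA : Defs.symmetric_form A.
Hypothesis oaA : forall y z, disjoint_elts y z ->
  diag_form A (y + z) = diag_form A y + diag_form A z.
Variable M : R.
Hypothesis M0 : 0 <= M.
Hypothesis bdA : forall x : 'I_n.+1 -> E, `|A x| <= M * \prod_(i < n.+1) `|x i|.

Definition abs_form : ('I_n.+1 -> E) -> R := cone_extension (pos_abs A).

Lemma abs_formE x : (forall k, 0 <= x k) -> abs_form x = pos_abs A x.
Proof.
apply: cone_extensionE => *; exact: (pos_absZ mlA M0 bdA).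
Qed.

Lemma abs_form_multilinear : multilinear_form abs_form.
Proof.
apply: cone_extension_multilinear => *; first exact: (pos_absD mlA symA oaA M0 bdA).
exact: (pos_absZ mlA M0 bdA).
Qed.

Lemma abs_form_ge x : (forall k, 0 <= x k) -> `|A x| <= abs_form x.
Proof.
move=> x0; rewrite abs_formE // ler_norml lerNl.
have h := bnd_id (x0 ord0).
rewrite -[X in - A X](dfwith_id x ord0) -[X in A X <= _](dfwith_id x ord0) -(mlN mlA).
by apply/andP; split; apply: (pos_abs_ge M0 bdA) => //; apply: bndN.
Qed.

(** For |y| <= x_0 the value of A at y is at most D at y^p + (- y)^p, and this
    element lies below x_0. *)
Lemma abs_form_least (D : ('I_n.+1 -> E) -> R) : multilinear_form D ->
  (forall x, (forall k, 0 <= x k) -> `|A x| <= D x) ->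
  forall x, (forall k, 0 <= x k) -> abs_form x <= D x.
Proof.
move=> mD AD x x0; rewrite abs_formE //.
apply: (pos_abs_le M0 bdA) => // y yx; have /andP[yl yr] := yx.
have pos z k : 0 <= z -> 0 <= dfwith x ord0 z k.
  by move=> z0; rewrite dfwithE; case: eqP.
have D0 z : 0 <= z -> 0 <= D (dfwith x ord0 z).
  by move=> z0; apply: le_trans (AD _ _) => // k; apply: pos.
have AB z : 0 <= z -> `|A (dfwith x ord0 z)| <= D (dfwith x ord0 z).
  by move=> z0; apply: AD => k; apply: pos.
have := AB _ (pos_part_ge0 y); have := AB _ (pos_part_ge0 (- y)).
have : 0 <= D (dfwith x ord0 (x ord0 - (y^p + (- y)^p))).
  apply: D0; rewrite bl_subr_ge0; apply: pos_partD_le => //.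
  by rewrite -(opprK (x ord0)) bl_lerN2.
have -> : A (dfwith x ord0 y) = A (dfwith x ord0 y^p) - A (dfwith x ord0 (- y)^p).
  by rewrite -(mlB mlA) pos_partB.
rewrite (mlB mD) (mlD mD) dfwith_id !ler_norml.
by move=> ? /andP[? ?] /andP[? ?]; lra.
Qed.

Lemma abs_form_norm x : `|abs_form x| <= abs_form (fun k => modulus (x k)).
Proof.
apply: form_dominated; try exact: abs_form_multilinear.
move=> y y0; rewrite ger0_norm //.
by apply: le_trans (abs_form_ge y0).
Qed.

Lemma abs_form_bounded x : `|abs_form x| <= M * \prod_(i < n.+1) `|x i|.
Proof.
apply: (le_trans (abs_form_norm x)).
have m0 k : 0 <= modulus (x k) by exact: modulus_ge0.
rewrite abs_formE //; apply: (pos_abs_le M0 bdA) => // y yx.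
apply: (le_trans (pos_abs_bound M0 bdA yx)).
by under eq_bigr do rewrite norm_modulus.
Qed.

(** Permuting the arguments of [abs_form] gives another multilinear form
    dominating A and - A, so minimality gives symmetry. *)
Lemma abs_form_symmetric : Defs.symmetric_form abs_form.
Proof.
have le1 (s : 'S_n.+1) x : (forall k, 0 <= x k) -> abs_form x <= abs_form (x \o s).
  apply: (abs_form_least (D := fun x => abs_form (x \o s))).
    exact: perm_multilinear abs_form_multilinear.
  by move=> y y0; rewrite -(symA s); apply: abs_form_ge => k /=.
move=> s x.
suff h : (fun z : 'I_n.+1 -> E => abs_form (z \o s)) = abs_form by exact: (congr1 (@^~ x) h).
apply: ml_eq_pos; [exact: perm_multilinear abs_form_multilinear|exact: abs_form_multilinear|].
move=> y y0; apply/le_anti; rewrite le1 // andbT.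
have := @le1 (s^-1)%g (y \o s) (fun k => y0 _).
by congr (_ <= abs_form _); apply/funext => k /=; rewrite permKV.
Qed.

Lemma abs_form_bounded_sym : bounded_sym_form abs_form.
Proof.
split; [exact: abs_form_multilinear | exists M; exact: abs_form_bounded | exact: abs_form_symmetric].
Qed.

Lemma form_bounded_sym : bounded_sym_form A.
Proof. by split => //; exists M. Qed.

(** By uniqueness of the symmetric form, the forms witnessing the two upper
    bounds of P and - P are A, - A and one common D. *)
Lemma abs_form_is_poly_abs : is_poly_abs n.+1 (diag_form A) (diag_form abs_form).
Proof.
have NA : bounded_sym_form (\- A) := oppr_bounded_sym form_bounded_sym.
split.
- exists A, abs_form; split; [split=> //; exact: form_bounded_sym|split=> //; exact: abs_form_bounded_sym|].
  by move=> x /abs_form_ge; apply: le_trans (ler_norm _).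
- exists (\- A), abs_form; split; [by []|split=> //; exact: abs_form_bounded_sym|].
  by move=> x /abs_form_ge; apply: le_trans; rewrite /= -normrN ler_norm.
- move=> S [C [D [[bC AC] [bD SD] CD]]] [C' [D' [[bC' AC'] [bD' SD'] CD']]].
  exists abs_form, D; split=> //; first by split=> //; exact: abs_form_bounded_sym.
  have CA : C = A by apply: form_unique => //; exact: form_bounded_sym.
  have CA' : C' = \- A by apply: form_unique.
  have DD : D' = D by apply: form_unique => //; rewrite -SD' SD.
  subst C C' D'.
  apply: abs_form_least; first by case: bD.
  by move=> x x0; rewrite ler_norml lerNl; apply/andP; split; [apply: CD' | apply: CD].
Qed.

Lemma poly_absE : poly_abs n.+1 (diag_form A) = diag_form abs_form.
Proof.
apply: xget_unique; first exact: abs_form_is_poly_abs.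
move=> Q [Q1 Q2 Qleast]; have [H1 H2 Hleast] := abs_form_is_poly_abs.
by apply: poly_le_anti; [apply: Qleast | apply: Hleast].
Qed.

Lemma diag_bounded (C : ('I_n.+1 -> E) -> R) (x : E) :
  (forall y : 'I_n.+1 -> E, `|C y| <= M * \prod_(i < n.+1) `|y i|) ->
  `|x| <= 1 -> `|diag_form C x| <= M.
Proof.
move=> bC x1; apply: (le_trans (bC _)); apply: ler_piMr => //.
by apply: prodr_ile1 => k _; rewrite normr_ge0.
Qed.

Lemma regular_norm_ge (x y : E) : `|x| <= 1 -> - x <= y <= x ->
  A (dfwith (fun=> x) ord0 y) <= regular_norm n.+1 (diag_form A).
Proof.
move=> x1 yx; have x0 := bnd_ge0 yx.
rewrite /regular_norm poly_absE /sup_norm.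
apply: (@le_trans _ _ `|diag_form abs_form x|).
  apply: le_trans (ler_norm _); rewrite /diag_form abs_formE //.
  exact: (@pos_abs_ge _ _ _ _ _ M0 bdA (fun=> x)).
apply: sup_upper_bound; last by exists x.
split; first by exists `|diag_form abs_form x|, x.
by exists M => _ [z z1 <-]; apply: diag_bounded => //; exact: abs_form_bounded.
Qed.

Lemma regular_norm_le (c : R) :
  (forall x y : E, `|x| <= 1 -> - x <= y <= x -> A (dfwith (fun=> x) ord0 y) <= c) ->
  regular_norm n.+1 (diag_form A) <= c.
Proof.
move=> h; rewrite /regular_norm poly_absE; apply: sup_norm_le => x x1.
apply: (le_trans (abs_form_norm _)).
have m0 : 0 <= modulus x by exact: modulus_ge0.
rewrite abs_formE //; apply: (pos_abs_le M0 bdA) => // y yx.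
by apply: h => //; rewrite norm_modulus.
Qed.

Lemma sup_norm_ge (x : E) : `|x| <= 1 -> `|diag_form A x| <= sup_norm (diag_form A).
Proof.
move=> x1; apply: sup_upper_bound; last by exists x.
split; first by exists `|diag_form A x|, x.
by exists M => _ [z z1 <-]; exact: diag_bounded.
Qed.

Lemma sup_norm_le_regular_norm :
  sup_norm (diag_form A) <= regular_norm n.+1 (diag_form A).
Proof.
apply: sup_norm_le => x x1.
have m0 : 0 <= modulus x by exact: modulus_ge0.
apply: (le_trans (@form_dominated _ _ _ A abs_form (fun=> x) mlA abs_form_multilinear abs_form_ge)).
rewrite abs_formE //; apply: (pos_abs_le M0 bdA) => // y yx.
by apply: regular_norm_ge => //; rewrite norm_modulus.
Qed.

Lemma regular_norm_le_double :
  regular_norm n.+1 (diag_form A) <= 2 * sup_norm (diag_form A).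
Proof.
apply: regular_norm_le => x y.
exact: (diagonal_bound mlA symA oaA M0 bdA sup_norm_ge).
Qed.

Lemma regular_norm_odd : odd n.+1 ->
  regular_norm n.+1 (diag_form A) = sup_norm (diag_form A).
Proof.
move=> on; apply/le_anti; rewrite sup_norm_le_regular_norm andbT.
apply: regular_norm_le => x y.
exact: (diagonal_bound_odd mlA symA oaA M0 bdA sup_norm_ge).
Qed.

End AbsoluteValue.

(** * The plane with the maximum norm *)

(** An alias, on which the normed space and the complete space structures of
    row vectors are joined; its norm is the maximum norm. *)
Definition plane (R : realType) := 'rV[R]_2.
HB.instance Definition _ (R : realType) := NormedModule.copy (plane R) 'rV[R]_2.
HB.instance Definition _ (R : realType) := CompletePseudoMetric.copy (plane R) 'rV[R]_2.

Section Plane.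
Context {R : realType}.
Implicit Types x y z : plane R.

Definition plane_le x y := [forall j : 'I_2, x ord0 j <= y ord0 j].
Definition plane_meet x y : plane R := \row_j Num.min (x ord0 j) (y ord0 j).
Definition plane_join x y : plane R := \row_j Num.max (x ord0 j) (y ord0 j).

Lemma plane_leP x y : reflect (forall j, x ord0 j <= y ord0 j) (plane_le x y).
Proof. exact: forallP. Qed.

Lemma plane_norm_leP x (c : R) : 0 <= c -> reflect (forall j, `|x ord0 j| <= c) (`|x| <= c).
Proof.
move=> c0; rewrite [`|x|]mx_normrE; apply: (iffP idP) => h.
  move=> j; apply: le_trans h.
  exact: (le_bigmax _ (fun ij : 'I_1 * 'I_2 => `|x ij.1 ij.2|) (ord0, j)).
by apply/bigmax_leP; split => // -[i j] _; rewrite /= ord1.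
Qed.

Lemma maxN_norm (a : R) : Num.max a (- a) = `|a|.
Proof.
apply/le_anti; rewrite ge_max ler_norm -normrN ler_norm /=.
rewrite normrN; case: (leP 0 a) => a0; first by rewrite ger0_norm // le_max lexx.
by rewrite ltr0_norm // le_max lexx orbT.
Qed.

Fact plane_le_refl : reflexive plane_le.
Proof. by move=> x; apply/plane_leP. Qed.
Fact plane_le_anti : antisymmetric plane_le.
Proof.
move=> x y /andP[/plane_leP xy /plane_leP yx].
by apply/rowP => j; apply/le_anti; rewrite xy yx.
Qed.
Fact plane_le_trans : transitive plane_le.
Proof.
by move=> y x z /plane_leP xy /plane_leP yz; apply/plane_leP => j; apply: le_trans (yz j).
Qed.
Fact plane_meetP x y z : plane_le x (plane_meet y z) = plane_le x y && plane_le x z.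
Proof.
apply/plane_leP/andP => [h|[/plane_leP xy /plane_leP xz] j]; last by rewrite mxE le_min xy xz.
by split; apply/plane_leP => j; have := h j; rewrite mxE le_min => /andP[].
Qed.
Fact plane_joinP x y z : plane_le (plane_join x y) z = plane_le x z && plane_le y z.
Proof.
apply/plane_leP/andP => [h|[/plane_leP xy /plane_leP xz] j]; last by rewrite mxE ge_max xy xz.
by split; apply/plane_leP => j; have := h j; rewrite mxE ge_max => /andP[].
Qed.
Fact plane_leD2r x y z : plane_le x y -> plane_le (x + z) (y + z).
Proof. by move=> /plane_leP xy; apply/plane_leP => j; rewrite !mxE lerD2r. Qed.
Fact plane_scale_ge0 (a : R) x : 0 <= a -> plane_le 0 x -> plane_le 0 (a *: x).
Proof.
move=> a0 /plane_leP x0; apply/plane_leP => j; rewrite !mxE mulr_ge0 //.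
by have := x0 j; rewrite mxE.
Qed.
Fact plane_le_norm x y :
  plane_le (plane_join x (- x)) (plane_join y (- y)) -> `|x| <= `|y|.
Proof.
move=> /plane_leP h; apply/plane_norm_leP => // j.
have := h j; rewrite !mxE !maxN_norm => /le_trans; apply.
by move: j; apply/plane_norm_leP.
Qed.

Definition plane_lattice : banachLatticeType R :=
  @BanachLattice R (plane R) plane_le plane_meet plane_join plane_le_refl
    plane_le_anti plane_le_trans plane_meetP plane_joinP plane_leD2r
    plane_scale_ge0 plane_le_norm.

Definition coordinate (j : 'I_2) (x : plane_lattice) : R := (x : plane R) ord0 j.

Lemma coordinate_le (x y : plane_lattice) j : x <= y -> coordinate j x <= coordinate j y.
Proof. by move=> /plane_leP; apply. Qed.

Lemma coordinateN (x : plane_lattice) j : coordinate j (- x) = - coordinate j x.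
Proof. by rewrite /coordinate mxE. Qed.

Lemma coordinateD (x y : plane_lattice) j :
  coordinate j (x + y) = coordinate j x + coordinate j y.
Proof. by rewrite /coordinate mxE. Qed.

Lemma coordinateZ (c : R) (x : plane_lattice) j :
  coordinate j (c *: x) = c * coordinate j x.
Proof. by rewrite /coordinate mxE. Qed.

Lemma coordinate_norm (x : plane_lattice) j : `|coordinate j x| <= `|x|.
Proof. by move: j; apply/(@plane_norm_leP x `|x|). Qed.

Lemma disjoint_coordinate (x y : plane_lattice) j : disjoint_elts x y ->
  coordinate j x = 0 \/ coordinate j y = 0.
Proof.
move=> h; have : plane_meet (plane_join x (- x)) (plane_join y (- y)) = 0 :> plane R := h.
move=> /rowP/(_ j); rewrite !mxE !maxN_norm -/(coordinate j x) -/(coordinate j y).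
by rewrite minEle; case: ifP => _ /normr0_eq0; [left|right].
Qed.

Section Forms.
Variables (n : nat) (c : R).

Definition plane_form (x : 'I_n.+1 -> plane_lattice) : R :=
  \prod_k coordinate ord0 (x k) - c * \prod_k coordinate ord_max (x k).

Lemma plane_form_bounded_sym : bounded_sym_form plane_form.
Proof.
have prodE (x : 'I_n.+1 -> plane_lattice) (i : 'I_n.+1) y j :
    \prod_k coordinate j (dfwith x i y k) =
    coordinate j y * \prod_(k < n.+1 | k != i) coordinate j (x k).
  rewrite (bigD1 i) //= dfwithin; congr (_ * _).
  by apply: eq_bigr => k ki; rewrite dfwithE (negbTE ki).
split.
- move=> x i k u w; rewrite /plane_form !prodE !coordinateD !coordinateZ; ring.
- exists (1 + `|c|) => x; rewrite /plane_form (le_trans (ler_normB _ _)) //.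
  have h j : `|\prod_k coordinate j (x k)| <= \prod_k `|x k|.
    rewrite normr_prod; apply: ler_prod => k _.
    by rewrite normr_ge0 coordinate_norm.
  by rewrite mulrDl mul1r lerD // normrM ler_wpM2l.
- by move=> s x; rewrite /plane_form; congr (_ - _ * _);
    rewrite [RHS](reindex_inj (@perm_inj _ s)).
Qed.

Lemma diag_plane_form (x : plane_lattice) :
  diag_form plane_form x = coordinate ord0 x ^+ n.+1 - c * coordinate ord_max x ^+ n.+1.
Proof. by rewrite /diag_form /plane_form !prodr_const card_ord. Qed.

Lemma plane_form_oa (x y : plane_lattice) : disjoint_elts x y ->
  diag_form plane_form (x + y) = diag_form plane_form x + diag_form plane_form y.
Proof.
move=> xy; have h j : coordinate j (x + y) ^+ n.+1 =
    coordinate j x ^+ n.+1 + coordinate j y ^+ n.+1.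
  by rewrite coordinateD; have [->|->] := disjoint_coordinate j xy;
    rewrite ?addr0 ?add0r expr0n /= ?addr0 ?add0r.
by rewrite !diag_plane_form !h; ring.
Qed.

Lemma plane_form_orth_additive : orth_additive_poly n.+1 (diag_form plane_form).
Proof.
split; last exact: plane_form_oa.
by exists plane_form => //; exact: plane_form_bounded_sym.
Qed.

(** Both s^n and c t^n lie between 0 and 1 on the unit ball, because n is even. *)
Lemma sup_norm_plane_form : ~~ odd n.+1 -> 0 <= c <= 1 ->
  sup_norm (diag_form plane_form) = 1.
Proof.
move=> en /andP[c0 c1]; apply/le_anti/andP; split.
  apply: sup_norm_le => x x1; rewrite diag_plane_form.
  have h j : 0 <= coordinate j x ^+ n.+1 <= 1.
    rewrite exprn_even_ge0 //= -[_ ^+ _]ger0_norm ?exprn_even_ge0 // normrX.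
    by rewrite exprn_ile1 // (le_trans (coordinate_norm _ _)).
  have /andP[a0 a1] := h ord0; have /andP[b0 b1] := h ord_max.
  have cb0 : 0 <= c * coordinate ord_max x ^+ n.+1 by rewrite mulr_ge0.
  have cb1 : c * coordinate ord_max x ^+ n.+1 <= 1 by rewrite mulr_ile1.
  by rewrite ler_norml; lra.
pose e1 : plane_lattice := (\row_j (j == ord0)%:R : plane R).
have e1j j : coordinate j e1 = (j == ord0)%:R by rewrite /coordinate mxE.
have -> : 1 = `|diag_form plane_form e1|.
  by rewrite diag_plane_form !e1j /= expr1n expr0n /= mulr0 subr0 normr1.
have e1n : `|e1| <= 1.
  apply/(@plane_norm_leP e1 1) => // j; rewrite mxE.
  by case: (_ == _); rewrite ?normr1 ?normr0.
have [_ /bounded_form_ge0[M M0 bM] _] := plane_form_bounded_sym.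
exact: (sup_norm_ge M0 bM).
Qed.
End Forms.
End Plane.

Theorem corollary1 (R : realType) (n : nat) (n_gt0 : (0 < n)%N) :
  [/\ forall (E : banachLatticeType R) (P : E -> R),
        orth_additive_poly n P ->
        (odd n -> regular_norm n P = sup_norm P) /\
        (~~ odd n -> sup_norm P <= regular_norm n P <= 2 * sup_norm P),
      ~~ odd n ->
        forall c : R,
          (forall (E : banachLatticeType R) (P : E -> R),
             orth_additive_poly n P -> c * sup_norm P <= regular_norm n P) ->
          c <= 1
    & ~~ odd n ->
        forall c : R,
          (forall (E : banachLatticeType R) (P : E -> R),
             orth_additive_poly n P -> regular_norm n P <= c * sup_norm P) ->
          2 <= c].
Proof.
case: n n_gt0 => // n _; split.
- move=> E P [[A [mA /bounded_form_ge0[M M0 bA] sA] ->] oa].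
  split=> [on|_]; first exact: (regular_norm_odd mA sA oa M0 bA on).
  by rewrite (sup_norm_le_regular_norm mA sA oa M0 bA) (regular_norm_le_double mA sA oa M0 bA).
- move=> en c /(_ _ _ (plane_form_orth_additive n 0)).
  rewrite sup_norm_plane_form ?lexx ?ler01 // mulr1 => /le_trans; apply.
  have [mA /bounded_form_ge0[M M0 bA] sA] := plane_form_bounded_sym n (0 : R).
  apply: (regular_norm_le mA sA (@plane_form_oa R n 0) M0 bA) => x y x1 /andP[xy yx].
  rewrite /plane_form mul0r subr0; apply: (le_trans (ler_norm _)).
  rewrite normr_prod; apply: prodr_ile1 => k _; rewrite normr_ge0 dfwithE /=.
  apply: le_trans x1; case: ifP => _; last exact: coordinate_norm.
  apply: le_trans (coordinate_norm x ord0).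
  have := coordinate_le ord0 xy; have := coordinate_le ord0 yx.
  rewrite coordinateN => h1 h2; apply: le_trans (ler_norm _).
  by rewrite ler_norml h1 h2.
- move=> en c /(_ _ _ (plane_form_orth_additive n 1)).
  rewrite sup_norm_plane_form ?lexx ?ler01 // mulr1; apply: le_trans.
  have [mA /bounded_form_ge0[M M0 bA] sA] := plane_form_bounded_sym n (1 : R).
  (* with x = (1, 1) and y = (1, -1) the form at (y, x, ..., x) is 1 + 1 *)
  pose x : plane_lattice := (const_mx 1 : plane R).
  pose y : plane_lattice := (\row_j (-1) ^+ j : plane R).
  have xj j : coordinate j x = 1 by rewrite /coordinate mxE.
  have yj j : coordinate j y = (-1) ^+ j by rewrite /coordinate mxE.
  have x1 : `|x| <= 1.
    by apply/(@plane_norm_leP R x 1) => // j; rewrite mxE normr1.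
  have yx : - x <= y <= x.
    by apply/andP; split; apply/plane_leP => j; rewrite !mxE -signr_odd; case: odd => /=;
      rewrite ?expr0 ?expr1 ?lexx //; lra.
  have := regular_norm_ge mA sA (@plane_form_oa R n 1) M0 bA x1 yx.
  apply: le_trans; rewrite /plane_form mul1r !big_ord_recl !dfwithin !yj.
  rewrite !big1 => [|k _|k _]; try by rewrite dfwithE.
  by rewrite /= expr0 expr1; lra.
Qed.
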